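(* Let $X$ be a compact connected cube complex that splits as a graph of virtually special cube complexes with locally constant vertex spaces. Then $X$ is virtually special.
   Context: Cube complexes: an $n$-cube is a copy of $[0,1]^n$; a cube complex is obtained by gluing cubes isometrically along subcubes; all cube complexes are assumed connected. A cube complex is nonpositively curved if the link of every vertex is a flag simplicial complex. A local isometry of nonpositively curved cube complexes is a combinatorial map $f:Y\to X$ such that for each vertex $v$ of $Y$ the induced map $\mathrm{lk}(v)\to\mathrm{lk}(f(v))$ is an embedding with image a full subcomplex. Graphs of spaces: a graph of nonpositively curved cube complexes $X_\Gamma$ over a connected graph $\Gamma$ consists of connected nonpositively curved cube complexes $X_v$ ($v\in V(\Gamma)$, vertex spaces) and $X_e$ ($e\in E(\Gamma)$, edge spaces) and locally isometric attaching maps $\phi_e^-:X_e\to X_{\iota(e)}$, $\phi_e^+:X_e\to X_{\tau(e)}$ for each edge $e$ with endpoints $\iota(e),\tau(e)$. Its total space is the quotient of $\bigsqcup_v X_v\sqcup\bigsqcup_e X_e\times[0,1]$ by $(x,0)\sim\phi_e^-(x)$, $(x,1)\sim\phi_e^+(x)$ for $x\in X_e$. A cube complex $X$ splits as $X_\Gamma$ if $X$ is the total space of $X_\Gamma$. It is a graph of virtually special cube complexes if the vertex and edge spaces are virtually special. Locally constant vertex spaces: for each $e\in E(\Gamma)$ there exists a cubical isometry $\theta_e:X_{\iota(e)}\to X_{\tau(e)}$ with $\theta_e\circ\phi_e^-=\phi_e^+$. Parallelism: for an edge $e$, $\overrightarrow{e}$ denotes $e$ with a chosen direction and $\overleftarrow{e}$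 the opposite direction. Two edges $a,b$ of $X$ are elementary parallel if there is a square $s:[0,1]^2\to X$ with $a=s([0,1]\times\{0\})$, $b=s([0,1]\times\{1\})$; directed edges $\overrightarrow a,\overrightarrow b$ are elementary parallel if moreover both are directed from $s(0,t)$ to $s(1,t)$ ($t=0,1$ respectively). Parallelism $\parallel$ (of edges, resp. directed edges) is the equivalence relation generated. Hyperplanes: a midcube of a cube $[0,1]^n$ is obtained by restricting one coordinate to $1/2$; hyperplanes of $X$ are the connected components of the space obtained from the disjoint union of all midcubes of cubes of $X$ by identifying faces of midcubes under inclusion. An edge is dual to a hyperplane $H$ if its midpoint is a $0$-cube of $H$; two edges are dual to the same hyperplane iff they are parallel. - $H$ is 2-sided if no directed edge $\overrightarrow e$ dual to $H$ satisfies $\overrightarrow e\parallel\overleftarrow e$. - $H_1,H_2$ cross if there are a vertex $v$ and edges $e_1,e_2$ incident to $v$, with $e_i$ dual to $H_i$, that are consecutive (at $v$) in a square of $X$. If $H_1=H_2=H$, $H$ crosses itself. - $H_1,H_2$ osculate if there are a vertex $v$ and edges $e_1,e_2$ incident to $v$, with $e_i$ dual to $H_i$, that are not consecutive in any square of $X$. - $H$ directly self-osculates if there are a vertex $v$ and distinct directed edges $\overrightarrow{e_1}\parallel\overrightarrow{e_2}$ dual to $H$, both with initial vertex $v$, such that $e_1,e_2$ are not consecutive in any square. - Two distinct hyperplanes inter-osculate if they both cross and osculate. A nonpositively curved cube complex is special if no hyperplane crosses itself, each hyperplane is 2-sided, no hyperplane directly self-osculates, and no two hyperplanes inter-osculate.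 A cube complex is virtually special if it admits a finite-sheeted cover that is special. *)

(* Defs.v *)
From mathcomp Require Import all_boot.
From Stdlib Require List Eqdep_dec.
From Stdlib Require Import Relations.

Set Implicit Arguments.
Unset Strict Implicit.
Unset Printing Implicit Defensive.

(** * Face maps between cubes *)

(* An affine function of one coordinate on [0,1]^m: [inl b] is the constant b,
   [inr (k, false)] is x_k and [inr (k, true)] is 1 - x_k. *)
Definition coord (m : nat) : Type := (bool + 'I_m * bool)%type.

Definition dir m (c : coord m) : option 'I_m :=
  if c is inr (k, _) then Some k else None.

Definition reflect_coord m (s : bool) (c : coord m) : coord m :=
  match c with
  | inl b => inl (s (+) b)
  | inr (k, t) => inr (k, s (+) t)
  end.

Definition subst_coord m p (g : 'I_m -> coord p) (c : coord m) : coord p :=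
  match c with
  | inl b => inl b
  | inr (k, s) => reflect_coord s (g k)
  end.

Definition is_face m n (f : 'I_n -> coord m) : bool :=
  [forall k : 'I_m, #|[pred j | dir (f j) == Some k]| == 1].

(* The isometries of [0,1]^m onto a face of [0,1]^n, given by their n coordinate
   functions.  For m = n these are the symmetries of the n-cube. *)
Record face_map (m n : nat) : Type := FaceMap {
  coords :> {ffun 'I_n -> coord m};
  face_mapP : is_face coords
}.

Arguments coords : simpl never.

Lemma is_faceP m n (f : 'I_n -> coord m) :
  (forall k, exists j, dir (f j) = Some k) ->
  (forall j j' k, dir (f j) = Some k -> dir (f j') = Some k -> j = j') ->
  is_face f.
Proof.
move=> fS fI; apply/forallP=> k; have [j jk] := fS k.
apply/eqP; rewrite -(card1 j); apply: eq_card => j'; rewrite !inE.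
by apply/eqP/eqP=> [j'k|->//]; apply: fI j'k jk.
Qed.

Lemma face_surj m n (f : face_map m n) k : exists j, dir (f j) = Some k.
Proof.
have /forallP/(_ k) fk := face_mapP f.
have /card_gt0P[j] : 0 < #|[pred j | dir (f j) == Some k]| by rewrite (eqP fk).
by rewrite inE => /eqP; exists j.
Qed.

Lemma face_inj m n (f : face_map m n) j j' k :
  dir (f j) = Some k -> dir (f j') = Some k -> j = j'.
Proof.
have /forallP/(_ k)/eqP fk := face_mapP f => jk j'k.
have /card_le1P/(_ j) H : #|[pred j | dir (f j) == Some k]| <= 1 by rewrite fk.
have := H _ j'; rewrite !inE jk j'k eqxx => /(_ isT) /esym/eqP.
by [].
Qed.

Lemma face_map_eq m n (f g : face_map m n) : (forall j, f j = g j) -> f = g.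
Proof.
case: f g => [f fP] [g gP] /= fg; have e : f = g by apply/ffunP.
by subst g; rewrite (bool_irrelevance fP gP).
Qed.

Definition mk_face m n (f : 'I_n -> coord m)
    (fS : forall k, exists j, dir (f j) = Some k)
    (fI : forall j j' k, dir (f j) = Some k -> dir (f j') = Some k -> j = j') :
  face_map m n.
Proof.
exists (finfun f); apply: is_faceP => [k|j j' k]; last by rewrite !ffunE; apply: fI.
by have [j jk] := fS k; exists j; rewrite ffunE.
Defined.

Lemma dir_reflect m s (c : coord m) : dir (reflect_coord s c) = dir c.
Proof. by case: c => [|[]]. Qed.

Lemma dir_subst m p (g : 'I_m -> coord p) c :
  dir (subst_coord g c) = obind (fun k => dir (g k)) (dir c).
Proof. by case: c => [|[k s]] //=; rewrite dir_reflect. Qed.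

Definition face_id n : face_map n n.
Proof.
apply: (@mk_face n n (fun j => inr (j, false))) => [k|j j' k]; first by exists k.
by move=> /= [->] [->].
Defined.

Definition face_comp m n p (f : face_map m n) (g : face_map p m) : face_map p n.
Proof.
apply: (@mk_face p n (fun j => subst_coord g (f j))) => [k|j j' k].
  have [l lk] := face_surj g k; have [j jl] := face_surj f l.
  by exists j; rewrite dir_subst jl.
rewrite !dir_subst.
case e: (dir (f j)) => [l|] //=; case e': (dir (f j')) => [l'|] //= lk l'k.
have ll' := face_inj lk l'k; rewrite -ll' in e'.
exact: face_inj e e'.
Defined.

Lemma face_idE n j : face_id n j = inr (j, false).
Proof. by rewrite ffunE. Qed.

Lemma face_compE m n p (f : face_map m n) (g : face_map p m) j :
  face_comp f g j = subst_coord g (f j).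
Proof. by rewrite ffunE. Qed.

Definition corner n : face_map 0 n.
Proof. by apply: (@mk_face 0 n (fun _ => inl false)) => [[]|]. Defined.

(* t |-> (0, ..., t, ..., 0), with t in position i *)
Definition axis n (i : 'I_n) : face_map 1 n.
Proof.
apply: (@mk_face 1 n (fun j => if j == i then inr (ord0, false) else inl false)).
  by move=> k; exists i; rewrite eqxx (ord1 k).
by move=> j j' k; case: eqP => // ->; case: eqP => // ->.
Defined.

(* t |-> 1 - t *)
Definition flip : face_map 1 1.
Proof.
apply: (@mk_face 1 1 (fun j => inr (j, true))) => [k|j j' k]; first by exists k.
by move=> /= [->] [->].
Defined.

(* t |-> (t, b) *)
Definition side (b : bool) : face_map 1 2.
Proof.
apply: (@mk_face 1 2 (fun j => if j == ord0 then inr (ord0, false) else inl b)).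
  by move=> k; exists ord0; rewrite (ord1 k).
by move=> j j' k; case: eqP => // ->; case: eqP => // ->.
Defined.

(** * Cube complexes *)

(* [cubes n] is the set of characteristic maps [0,1]^n -> X of n-cubes; an
   n-cube of X is an orbit of characteristic maps under the symmetries of
   [0,1]^n, which act freely.  In particular [cubes 0] is the set of vertices
   and [cubes 1] is the set of directed edges. *)
Record cube_complex : Type := CubeComplex {
  cubes :> nat -> Type;
  face : forall m n, face_map m n -> cubes n -> cubes m;
  face_1 : forall n (c : cubes n), face (face_id n) c = c;
  face_c : forall m n p (f : face_map m n) (g : face_map p m) (c : cubes n),
    face (face_comp f g) c = face g (face f c);
  face_free : forall n (f : face_map n n) (c : cubes n),
    face f c = c -> f = face_id n
}.

Record cmap (X Y : cube_complex) : Type := CMap {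
  cmap_fun :> forall n, X n -> Y n;
  cmap_face : forall m n (f : face_map m n) (c : X n),
    cmap_fun (face f c) = face f (cmap_fun c)
}.

Definition cubical_isometry (X Y : cube_complex) (f : cmap X Y) : Prop :=
  forall n, bijective (f n).

Definition base (X : cube_complex) n (c : X n) : X 0 := face (corner n) c.

Definition rev_edge (X : cube_complex) (e : X 1) : X 1 := face flip e.

Definition init (X : cube_complex) (e : X 1) : X 0 := base e.
Definition term (X : cube_complex) (e : X 1) : X 0 := init (rev_edge e).

Definition connected (X : cube_complex) : Prop :=
  inhabited (X 0) /\
  forall u v : X 0,
    clos_refl_sym_trans (X 0)
      (fun u v => exists e : X 1, init e = u /\ term e = v) u v.

(* A cube complex is compact when it has finitely many cubes. *)
Definition compact (X : cube_complex) : Prop :=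
  exists l : list {n : nat & X n}, forall c, List.In c l.

(** * Links *)

(* The vertices of lk(v) are the directed edges [e] with [init e = v], and a
   cube [c : X n] with [base c = v] is an (n-1)-simplex of lk(v) with an
   ordering of its vertices, the i-th vertex being [face (axis i) c]. *)

(* Each simplex has distinct vertices and is determined by them.  (Reordering
   the vertices of a simplex permutes the coordinates of the cube, so it is
   enough to compare simplices with the same ordered vertices.) *)
Definition link_simplicial (X : cube_complex) (v : X 0) : Prop :=
  (forall n (c : X n), base c = v ->
     injective (fun i : 'I_n => face (axis i) c)) /\
  (forall n (c c' : X n), base c = v -> base c' = v ->
     (forall i : 'I_n, face (axis i) c = face (axis i) c') -> c = c').

(* [consecutive e1 e2]: [e1], [e2] are the two sides of a square at its corner,
   which is their common initial vertex; that is, they are adjacent in the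
   link of that vertex. *)
Definition consecutive (X : cube_complex) (e1 e2 : X 1) : Prop :=
  exists s : X 2, face (axis (ord0 : 'I_2)) s = e1 /\
                  face (axis (ord_max : 'I_2)) s = e2.

Definition link_flag (X : cube_complex) (v : X 0) : Prop :=
  forall n (e : 'I_n -> X 1),
    (forall i, init (e i) = v) ->
    (forall i j, i != j -> e i <> e j /\ consecutive (e i) (e j)) ->
    exists c : X n, base c = v /\ forall i, face (axis i) c = e i.

Definition nonpositively_curved (X : cube_complex) : Prop :=
  forall v : X 0, link_simplicial v /\ link_flag v.

(* lk(v) -> lk(f(v)) is injective, with image a full subcomplex. *)
Definition local_isometry (Y X : cube_complex) (f : cmap Y X) : Prop :=
  forall v : Y 0,
    (forall e e' : Y 1, init e = v -> init e' = v -> f _ e = f _ e' -> e = e') /\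
    (forall n (c : X n), base c = f _ v ->
       (forall i : 'I_n, exists e : Y 1, init e = v /\ f _ e = face (axis i) c) ->
       exists c' : Y n, base c' = v /\ f _ c' = c).

(* A covering map is a surjective map inducing isomorphisms of links. *)
Definition covering (Y X : cube_complex) (p : cmap Y X) : Prop :=
  (forall x : X 0, exists y : Y 0, p _ y = x) /\
  (forall (y : Y 0) n (c : X n), base c = p _ y ->
     exists! c' : Y n, base c' = y /\ p _ c' = c).

Definition finite_sheeted (Y X : cube_complex) (p : cmap Y X) : Prop :=
  forall x : X 0, exists l : list (Y 0), forall y, p _ y = x -> List.In y l.

(** * Hyperplanes *)

Definition elementary_parallel (X : cube_complex) (a b : X 1) : Prop :=
  exists s : X 2, a = face (side false) s /\ b = face (side true) s.

(* parallelism of directed edges *)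
Definition parallel (X : cube_complex) : X 1 -> X 1 -> Prop :=
  clos_refl_sym_trans (X 1) (@elementary_parallel X).

(* The midcube of [mid_cube] where the coordinate [mid_dir] equals 1/2 *)
Record midcube (X : cube_complex) : Type := MidCube {
  mid_dim : nat;
  mid_cube : X mid_dim;
  mid_dir : 'I_mid_dim
}.

Definition midcube_face (X : cube_complex) (M M' : midcube X) : Prop :=
  exists f : face_map (mid_dim M) (mid_dim M'),
    mid_cube M = face f (mid_cube M') /\
    dir (f (mid_dir M')) = Some (mid_dir M).

(* A hyperplane, as the set of the midcubes it consists of. *)
Definition hyperplane (X : cube_complex) (H : midcube X -> Prop) : Prop :=
  exists M, forall M',
    H M' <-> clos_refl_sym_trans (midcube X) (@midcube_face X) M M'.

Definition dual (X : cube_complex) (e : X 1) (H : midcube X -> Prop) : Prop :=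
  H (MidCube e ord0).

(* An edge incident to v is directed away from v, so that a loop at v occurs
   twice: an edge at v is a vertex of lk(v). *)

Definition cross (X : cube_complex) (H1 H2 : midcube X -> Prop) : Prop :=
  exists (v : X 0) (e1 e2 : X 1),
    init e1 = v /\ init e2 = v /\ dual e1 H1 /\ dual e2 H2 /\
    consecutive e1 e2.

Definition osculate (X : cube_complex) (H1 H2 : midcube X -> Prop) : Prop :=
  exists (v : X 0) (e1 e2 : X 1),
    init e1 = v /\ init e2 = v /\ dual e1 H1 /\ dual e2 H2 /\
    ~ consecutive e1 e2.

Definition two_sided (X : cube_complex) (H : midcube X -> Prop) : Prop :=
  forall e : X 1, dual e H -> ~ parallel e (rev_edge e).

Definition directly_self_osculates (X : cube_complex) (H : midcube X -> Prop) :
    Prop :=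
  exists (v : X 0) (e1 e2 : X 1),
    init e1 = v /\ init e2 = v /\ e1 <> e2 /\ parallel e1 e2 /\
    dual e1 H /\ dual e2 H /\ ~ consecutive e1 e2.

Definition inter_osculate (X : cube_complex) (H1 H2 : midcube X -> Prop) : Prop :=
  H1 <> H2 /\ cross H1 H2 /\ osculate H1 H2.

Definition special (X : cube_complex) : Prop :=
  nonpositively_curved X /\
  (forall H, @hyperplane X H -> ~ cross H H) /\
  (forall H, @hyperplane X H -> two_sided H) /\
  (forall H, @hyperplane X H -> ~ directly_self_osculates H) /\
  (forall H1 H2, @hyperplane X H1 -> @hyperplane X H2 -> ~ inter_osculate H1 H2).

Definition virtually_special (X : cube_complex) : Prop :=
  exists (Y : cube_complex) (p : cmap Y X),
    connected Y /\ covering p /\ finite_sheeted p /\ special Y.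

(** * The product of a cube complex with an interval *)

Definition base_dim n (c : coord n) : nat := if c is inr _ then n.-1 else n.

(* the coordinates of [0,1]^n other than that on which [c] depends *)
Definition keep n (c : coord n) : 'I_(base_dim c) -> 'I_n :=
  match c with
  | inl _ => fun j => j
  | inr ks => lift ks.1
  end.

(* [d] as a function of the coordinates in [keep c]; the value [inl false] is
   never used. *)
Definition forget n (c d : coord n) : coord (base_dim c) :=
  match c with
  | inl _ => d
  | inr ks =>
      match d with
      | inl b => inl b
      | inr (l, t) => if unlift ks.1 l is Some l' then inr (l', t) else inl false
      end
  end.

Lemma dir_forget n (c d : coord n) (k : 'I_(base_dim c)) :
  dir (forget c d) = Some k <-> dir d = Some (keep k).
Proof.
case: c k => [b|[i s]] k //; case: d => [b|[l t]] //=.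
case: unliftP => [l' ->|->] /=.
  by split=> [/Some_inj->|/Some_inj/lift_inj->].
by split=> // /Some_inj/eqP; rewrite (negPf (neq_lift _ _)).
Qed.

Lemma keepP n (c : coord n) (j : 'I_n) :
  dir c <> Some j -> exists j', j = @keep n c j'.
Proof.
case: c => [b|[i s]] /= ; first by exists j.
by case: (unliftP i j) => [j' ->|->] // _; exists j'.
Qed.

Lemma keep_inj n (c : coord n) : injective (@keep n c).
Proof. by case: c => [b|[i s]] //=; apply: lift_inj. Qed.

Lemma keep_dir n (c : coord n) j : dir c <> Some (@keep n c j).
Proof.
case: c j => [b|[i s]] //= j /Some_inj/eqP.
by rewrite (negPf (neq_lift _ _)).
Qed.

(* the face map induced on the remaining coordinates *)
Definition base_face m n (f : face_map m n) (c : coord n) :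
  face_map (base_dim (subst_coord f c)) (base_dim c).
Proof.
apply: (@mk_face _ _ (fun j => forget (subst_coord f c) (f (keep j)))).
  move=> k; have [j jk] := face_surj f (keep k).
  have [j0|j' j'j] := @keepP n c j.
    by case: (@keep_dir _ (subst_coord f c) k); rewrite dir_subst j0.
  by exists j'; apply/dir_forget; rewrite -j'j.
move=> j j' k /dir_forget jk /dir_forget j'k.
exact: keep_inj (face_inj jk j'k).
Defined.

Lemma base_faceE m n (f : face_map m n) (c : coord n) j :
  base_face f c j = forget (subst_coord f c) (f (keep j)).
Proof. by rewrite ffunE. Qed.

(* dimension-free values of coordinates, to compare across equal dimensions *)
Definition cval n (c : coord n) : bool + nat * bool :=
  match c with inl b => inl b | inr (k, s) => inr (val k, s) end.

Lemma cval_inj n : injective (@cval n).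
Proof.
by move=> [b|[k s]] [b'|[k' s']] //= [] => [->|/val_inj-> ->].
Qed.

Section CylinderLaws.

Variable Y : cube_complex.

Definition cyl_cube (n : nat) : Type := {c : coord n & Y (base_dim c)}.

Definition cyl_face m n (f : face_map m n) (z : cyl_cube n) : cyl_cube m :=
  existT _ (subst_coord f (projT1 z)) (face (base_face f (projT1 z)) (projT2 z)).

Lemma cyl_eq n N (c c' : coord n) (h : face_map (base_dim c) N)
    (h' : face_map (base_dim c') N) (y : Y N) :
  c = c' -> (forall j, cval (h j) = cval (h' j)) ->
  existT (fun c : coord n => Y (base_dim c)) c (face h y)
    = existT _ c' (face h' y).
Proof.
move=> cc'; subst c' => hh'; congr existT; congr face.
by apply: face_map_eq => j; apply: cval_inj.
Qed.

Lemma cyl_eq_inv n (c c' : coord n) (h : face_map (base_dim c') (base_dim c))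
    (y : Y (base_dim c)) :
  existT (fun c : coord n => Y (base_dim c)) c' (face h y) = existT _ c y ->
  forall j, cval (h j) = inr (val j, false).
Proof.
move=> e; have c'c : c' = c by have := congr1 (@projT1 _ _) e.
subst c'.
have /face_free-> : face h y = y.
  have dec (a b : coord n) : {a = b} + {a <> b} by case: (a =P b); [left|right].
  exact: Eqdep_dec.inj_pair2_eq_dec dec _ _ _ _ e.
by move=> j; rewrite face_idE.
Qed.

Lemma subst_coord_id n (c : coord n) : subst_coord (face_id n) c = c.
Proof. by case: c => [|[k s]] //=; rewrite face_idE /= addbF. Qed.

Lemma subst_coord_comp m n p (f : face_map m n) (g : face_map p m) c :
  subst_coord (face_comp f g) c = subst_coord g (subst_coord f c).
Proof.
case: c => [|[k s]] //=; rewrite face_compE.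
by case: (f k) => [|[l t]] //=; case: (g l) => [b|[l' t']] //=; rewrite addbA.
Qed.

Lemma forget_keep n (c : coord n) (j : 'I_(base_dim c)) s :
  forget c (inr (keep j, s)) = inr (j, s).
Proof. by case: c j => [b|[k t]] j //=; rewrite liftK. Qed.

Lemma cyl_face_1 n (z : cyl_cube n) : cyl_face (face_id n) z = z.
Proof.
case: z => c y; rewrite /cyl_face /= -[in RHS](face_1 y).
apply: cyl_eq => [|j]; first exact: subst_coord_id.
rewrite base_faceE !face_idE; rewrite subst_coord_id.
by rewrite forget_keep.
Qed.

Lemma forget_const n (c : coord n) b : forget c (inl b) = inl b.
Proof. by case: c => [|[]]. Qed.

Lemma forget_subst m p (g : face_map p m) (c d : coord m) :
  (forall k, dir d = Some k -> dir c <> Some k) ->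
  subst_coord (base_face g c) (forget c d) = forget (subst_coord g c) (subst_coord g d).
Proof.
case: d => [b|[l t]] H; first by rewrite !forget_const.
have [l' e] : exists l', l = @keep m c l' by apply: keepP => /(H _ erefl).
rewrite {}e {H} forget_keep /= base_faceE.
have N k : dir (g (keep l')) = Some k -> dir (subst_coord g c) <> Some k.
  move=> lk; rewrite dir_subst; case e: (dir c) => [i|] //= ik.
  by have := @keep_dir m c l'; rewrite e (face_inj ik lk).
move: (subst_coord g c) (g _) N => c' [b|[k s]] /= N; first by rewrite !forget_const.
case: c' N => [b|[i u]] //= N; case: unliftP => [//|ki].
by case: (N k erefl); rewrite ki.
Qed.

Lemma cyl_face_c m n p (f : face_map m n) (g : face_map p m) (z : cyl_cube n) :
  cyl_face (face_comp f g) z = cyl_face g (cyl_face f z).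
Proof.
case: z => c y; rewrite /cyl_face /= -face_c.
apply: cyl_eq => [|j]; first exact: subst_coord_comp.
rewrite face_compE !base_faceE face_compE subst_coord_comp forget_subst //.
move=> k jk; rewrite dir_subst; case e: (dir c) => [i|] //= ik.
by have := @keep_dir n c j; rewrite e; case; rewrite (face_inj ik jk).
Qed.

Lemma forget_inv n (c d : coord n) (j : 'I_(base_dim c)) s :
  forget c d = inr (j, s) -> d = inr (keep j, s).
Proof.
case: c j => [b|[i t]] j //=; case: d => [b|[l u]] //=.
by case: unliftP => //= l' -> [-> ->].
Qed.

Lemma cyl_face_free n (f : face_map n n) (z : cyl_cube n) :
  cyl_face f z = z -> f = face_id n.
Proof.
case: z => c y; rewrite /cyl_face /= => e; apply: face_map_eq => i.
have cc : subst_coord f c = c by have := congr1 (@projT1 _ _) e.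
rewrite face_idE; case: (@eqP _ (dir c) (Some i)) => [ci|/keepP[j ->]].
  case: c ci {e y} cc => [//|[k s]] /= [->] {k}.
  by case: (f i) => [//|[l t]] /= [-> /(canRL (addKb s))->]; rewrite addbb.
apply: forget_inv; apply: cval_inj.
have := cyl_eq_inv e j; rewrite base_faceE.
by move: (f (keep j)); rewrite cc.
Qed.

(* [cylinder] is Y x [0,1].  The pair (c, y) is the cube
   x |-> (y (x'), c (x)), where x' is x without its coordinate number [dir c];
   thus (inl b, y) is the cube y x {b}, and (inr (k, s), y) is the cube
   y x [0,1] with k-th coordinate in the direction of [0,1]. *)
Definition cylinder : cube_complex :=
  CubeComplex cyl_face_1 cyl_face_c cyl_face_free.

Definition level (b : bool) n (y : Y n) : cylinder n :=
  existT (fun c : coord n => Y (base_dim c)) (inl b) y.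

End CylinderLaws.

(** * Graphs of cube complexes *)

Record graph : Type := Graph {
  vertex : Type;
  edge : Type;
  iota : edge -> vertex;
  tau : edge -> vertex
}.

Definition connected_graph (G : graph) : Prop :=
  inhabited (vertex G) /\
  forall u v : vertex G,
    clos_refl_sym_trans (vertex G)
      (fun u v => exists e : edge G, iota e = u /\ tau e = v) u v.

Record graph_of_spaces (G : graph) : Type := GraphOfSpaces {
  vspace : vertex G -> cube_complex;
  espace : edge G -> cube_complex;
  attach_minus : forall e, cmap (espace e) (vspace (iota e));
  attach_plus : forall e, cmap (espace e) (vspace (tau e));
  vspace_connected : forall v, connected (vspace v);
  espace_connected : forall e, connected (espace e);
  vspace_npc : forall v, nonpositively_curved (vspace v);
  espace_npc : forall e, nonpositively_curved (espace e);
  attach_minus_isometry : forall e, local_isometry (attach_minus e);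
  attach_plus_isometry : forall e, local_isometry (attach_plus e)
}.

Section TotalSpace.

Variables (G : graph) (XG : graph_of_spaces G).

(* the n-cubes of the disjoint union of the X_v and the X_e x [0,1] *)
Inductive piece (n : nat) : Type :=
| vpiece (v : vertex G) (c : vspace XG v n)
| epiece (e : edge G) (z : cylinder (espace XG e) n).

Inductive glue (n : nat) : piece n -> piece n -> Prop :=
| glue_minus (e : edge G) (c : espace XG e n) :
    glue (epiece (level false c)) (vpiece (attach_minus XG e _ c))
| glue_plus (e : edge G) (c : espace XG e n) :
    glue (epiece (level true c)) (vpiece (attach_plus XG e _ c)).

Variables (X : cube_complex)
  (pv : forall v, cmap (vspace XG v) X)
  (pe : forall e, cmap (cylinder (espace XG e)) X).

Definition piece_map n (z : piece n) : X n :=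
  match z with
  | vpiece v c => pv v _ c
  | epiece e c => pe e _ c
  end.

(* X is the quotient of the disjoint union by the equivalence relation
   generated by [glue]. *)
Definition quotient_map : Prop :=
  forall n,
    (forall c : X n, exists z : piece n, piece_map z = c) /\
    (forall z z' : piece n,
       piece_map z = piece_map z' <-> clos_refl_sym_trans (piece n) (@glue n) z z').

End TotalSpace.

Definition splits_as (X : cube_complex) (G : graph) (XG : graph_of_spaces G) :
    Prop :=
  exists (pv : forall v, cmap (vspace XG v) X)
         (pe : forall e, cmap (cylinder (espace XG e)) X),
    quotient_map pv pe.

Definition graph_of_virtually_special (G : graph) (XG : graph_of_spaces G) :
    Prop :=
  (forall v, virtually_special (vspace XG v)) /\
  (forall e, virtually_special (espace XG e)).

Definition locally_constant (G : graph) (XG : graph_of_spaces G) : Prop :=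
  forall e : edge G,
    exists theta : cmap (vspace XG (iota e)) (vspace XG (tau e)),
      cubical_isometry theta /\
      forall n (c : espace XG e n),
        theta _ (attach_minus XG e _ c) = attach_plus XG e _ c.

(* Main.v *)
Require Import Defs.
From mathcomp Require Import all_boot.
From Stdlib Require Import Relations Classical ClassicalEpsilon.
From Stdlib Require Import FunctionalExtensionality PropExtensionality ProofIrrelevance.

Set Implicit Arguments.
Unset Strict Implicit.
Unset Printing Implicit Defensive.

(* Let B be one of the vertex spaces and Z -> B a finite special cover.  Marking
   the vertex spaces by isometries with B (there are finitely many) gives a finite
   cover of X all of whose attaching maps come in equal pairs Y_j -> B, so that it
   maps to B; pull Z back along this map, and Y_j back to a local isometry
   P -> Z.  The edges of P in a given parallelism class of Z define a partial
   bijection of the vertices of P; these are completed to permutations p_a of a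
   finite set F so that p_a and p_b commute when the hyperplanes of a and b cross.
   The corresponding regular cover is special: parallel vertical edges have
   parallel images in Z, which settles all cases but those involving an edge in the
   direction of the graph.  There, regularity shows that the hyperplane of such an
   edge meets a vertex in at most one edge, and the property of p_a of following an
   edge of P at a given point, rather than an edge added in the completion, is
   unchanged by p_b when a and b cross, which excludes inter-osculation. *)

(** One marking per vertex space would not do: composing the isometries [theta] around a cycle of
    the graph may give a nontrivial automorphism of B, so all markings are kept. The cover they
    define is never built as a complex: a [chart_system] records how its pieces map to X and to B,
    and the final cover is built over X in one go. Its vertices carry maps g of F rather than points
    of F, because a strip edge over a vertex t of P is controlled only at the point [i t]: over a
    label outside the image of [i], nothing would prevent two parallel strip edges from starting at
    the same vertex. A surjective g takes the value [i t] at some base point, and this base point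
    serves all along the hyperplane. The orbits of a partial bijection are cycles and segments. The
    completion closes each segment into a cycle, run once forwards and once backwards according to a
    sign. One sign per hyperplane, instead of a common one, lets crossing hyperplanes be completed
    independently. Specialness of Z makes the partial bijections well defined, makes those of
    crossing hyperplanes commute where both are defined, and keeps the signs of crossing hyperplanes
    distinct. *)

(** * Vertices, edges and squares of a cube *)

Lemma face_comp_assoc m n p r (f : face_map m n) (g : face_map p m)
    (h : face_map r p) :
  face_comp (face_comp f g) h = face_comp f (face_comp g h).
Proof.
apply: face_map_eq => j; rewrite !face_compE -subst_coord_comp.
by case: (f j) => [|[k s]] //=; rewrite face_compE.
Qed.

Lemma face_id_comp m n (f : face_map m n) : face_comp (face_id n) f = f.
Proof.
by apply: face_map_eq => j; rewrite face_compE face_idE /=; case: (f j) => [|[]].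
Qed.

Definition vert n (b : 'I_n -> bool) : face_map 0 n.
Proof. by apply: (@mk_face 0 n (fun j => inl (b j))) => [[]|]. Defined.

(** The value [b i] is ignored, so [b] is determined only away from [i]; the endpoints are obtained
    by setting it to [false] and [true] with [upd]. *)
Definition edge_at n (b : 'I_n -> bool) (i : 'I_n) : face_map 1 n.
Proof.
apply: (@mk_face 1 n (fun j => if j == i then inr (ord0, false) else inl (b j))).
  by move=> k; exists i; rewrite eqxx (ord1 k).
by move=> j j' k; case: eqP => // ->; case: eqP => // ->.
Defined.

Definition square_at n (b : 'I_n -> bool) (i i' : 'I_n) (ii' : i != i') :
  face_map 2 n.
Proof.
apply: (@mk_face 2 n (fun j => if j == i then inr (ord0, false) else
                               if j == i' then inr (ord_max, false) else inl (b j))).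
  move=> k; have [->|->] : k = ord0 \/ k = ord_max.
    by case: k => [[|[|k]]] // lk; [left|right]; apply: val_inj.
    by exists i; rewrite eqxx.
  by exists i'; rewrite eqxx eq_sym (negPf ii').
move=> j j' k; case: eqP => [->|_] /=.
  by move=> [<-]; case: eqP => [//|_]; case: eqP.
by case: eqP => [->|//] [<-]; case: eqP => [//|_]; case: eqP.
Defined.

Lemma vertE n (b : 'I_n -> bool) j : vert b j = inl (b j).
Proof. by rewrite ffunE. Qed.

Lemma edge_atE n (b : 'I_n -> bool) i j :
  edge_at b i j = if j == i then inr (ord0, false) else inl (b j).
Proof. by rewrite ffunE. Qed.

Lemma square_atE n (b : 'I_n -> bool) i i' (ii' : i != i') j :
  square_at b ii' j = if j == i then inr (ord0, false) else
                      if j == i' then inr (ord_max, false) else inl (b j).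
Proof. by rewrite ffunE. Qed.

Lemma cornerE n j : corner n j = inl false.
Proof. by rewrite ffunE. Qed.

Lemma axisE n (i j : 'I_n) :
  axis i j = if j == i then inr (ord0, false) else inl false.
Proof. by rewrite ffunE. Qed.

Lemma flipE j : flip j = inr (j, true).
Proof. by rewrite ffunE. Qed.

Lemma sideE b (j : 'I_2) :
  side b j = if j == ord0 then inr (ord0, false) else inl b.
Proof. by rewrite ffunE. Qed.

Definition faceE := (face_compE, vertE, edge_atE, square_atE, cornerE, axisE,
  flipE, sideE, face_idE).

Lemma coord0 (c : coord 0) : exists b, c = inl b.
Proof. by case: c => [b|[[]]] //; exists b. Qed.

Definition bits n (k : face_map 0 n) (j : 'I_n) : bool := k j == inl true.

Lemma vert_bits n (k : face_map 0 n) : vert (bits k) = k.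
Proof.
apply: face_map_eq => j; rewrite faceE /bits.
by have [[] ->] := coord0 (k j).
Qed.

Lemma face_map0_eq (k : face_map 0 0) : k = face_id 0.
Proof. by apply: face_map_eq => -[]. Qed.

Definition upd n (b : 'I_n -> bool) i x : 'I_n -> bool :=
  fun j => if j == i then x else b j.

Definition tip : face_map 0 1 := face_comp flip (corner 1).

Lemma tipE j : tip j = inl true.
Proof. by rewrite /tip !faceE /= !faceE. Qed.

Lemma edge_at_init n (b : 'I_n -> bool) i :
  face_comp (edge_at b i) (corner 1) = vert (upd b i false).
Proof. by apply: face_map_eq => j; rewrite !faceE /upd; case: eqP; rewrite //= !faceE. Qed.

Lemma edge_at_tip n (b : 'I_n -> bool) i :
  face_comp (edge_at b i) tip = vert (upd b i true).
Proof. by apply: face_map_eq => j; rewrite !faceE /upd; case: eqP; rewrite //= tipE. Qed.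

Lemma flip_flip : face_comp flip flip = face_id 1.
Proof. by apply: face_map_eq => j; rewrite !faceE /= !faceE. Qed.

Lemma flip_tip : face_comp flip tip = corner 1.
Proof. by rewrite /tip -face_comp_assoc flip_flip face_id_comp. Qed.

Lemma edge_mapP n (g : face_map 1 n) i :
  dir (g i) = Some ord0 ->
  exists b, g = edge_at b i \/ g = face_comp (edge_at b i) flip.
Proof.
move=> gi; exists (fun j => g j == inl true).
have gj j : j != i -> g j = inl (g j == inl true).
  case e: (g j) => [[]|[k t]] // /eqP[]; apply: (@face_inj 1 n g j i ord0) => //.
  by rewrite e /= (ord1 k).
case e: (g i) => [b|[k t]]; first by rewrite e in gi.
rewrite (ord1 k) in e; case: t e => e; [right|left]; apply: face_map_eq => j;
  rewrite !faceE; case: eqP => [->|/eqP/gj //]; by rewrite /= ?faceE ?e.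
Qed.

Lemma edge_mapP' n (g : face_map 1 n) :
  exists b i, g = edge_at b i \/ g = face_comp (edge_at b i) flip.
Proof.
by have [i /edge_mapP[b e]] := face_surj g ord0; exists b, i.
Qed.

(** * Endpoints and reversal of edges *)

Section FaceIdentities.

Variable X : cube_complex.
Implicit Types (e : X 1) (c : X 2).

Lemma faceC m n p (f : face_map m n) (g : face_map p m) (c : X n) :
  face g (face f c) = face (face_comp f g) c.
Proof. by rewrite face_c. Qed.

Lemma rev_edgeK e : rev_edge (rev_edge e) = e.
Proof. by rewrite /rev_edge faceC flip_flip face_1. Qed.

Lemma term_tip e : term e = face tip e.
Proof. by rewrite /term /init /base /rev_edge faceC. Qed.

Lemma init_rev e : init (rev_edge e) = term e.
Proof. by []. Qed.

Lemma term_rev e : term (rev_edge e) = init e.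
Proof. by rewrite /term rev_edgeK. Qed.

Lemma base_axis n (i : 'I_n) (c : X n) : init (face (axis i) c) = base c.
Proof.
rewrite /init /base faceC; congr face; apply: face_map_eq => j.
by rewrite !faceE; case: eqP => //= _; rewrite faceE.
Qed.

Lemma base0 (v : X 0) : base v = v.
Proof. by rewrite /base (face_map0_eq (corner 0)) face_1. Qed.

End FaceIdentities.

Lemma cmap_base (X Y : cube_complex) (f : cmap X Y) n (c : X n) :
  f _ (base c) = base (f _ c).
Proof. exact: cmap_face. Qed.

Lemma cmap_init (X Y : cube_complex) (f : cmap X Y) (e : X 1) :
  f _ (init e) = init (f _ e).
Proof. exact: cmap_face. Qed.

Lemma cmap_rev (X Y : cube_complex) (f : cmap X Y) (e : X 1) :
  f _ (rev_edge e) = rev_edge (f _ e).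
Proof. exact: cmap_face. Qed.

(** * Covers with prescribed monodromy *)

Section Cover.

(** [S] is the vertex set of the future cover, [q] its projection, and [T e s s'] says that the lift
    of [e] starting at [s] ends at [s']. Besides path lifting, the only condition is that squares
    have trivial monodromy; higher cubes then lift because any two monotone paths in a cube differ
    by moves across squares. *)
Variables (X : cube_complex) (S : Type) (q : S -> X 0) (T : X 1 -> S -> S -> Prop).

Hypothesis T_init : forall e s s', T e s s' -> q s = init e.
Hypothesis T_rev : forall e s s', T e s s' -> T (rev_edge e) s' s.
Hypothesis T_fun : forall e s s' s'', T e s s' -> T e s s'' -> s' = s''.
Hypothesis T_ex : forall e s, q s = init e -> exists s', T e s s'.

(** The sides of the unit square opposite to [axis ord0] and, for [far1], to [axis ord_max]. *)
Definition far0 : face_map 1 2 := edge_at (fun _ => true) ord0.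
Definition far1 : face_map 1 2 := edge_at (fun _ => true) ord_max.

Hypothesis T_square : forall (c : X 2) s, q s = base c ->
  exists s0 s1 s01,
    [/\ T (face (axis ord0) c) s s0, T (face (axis ord_max) c) s s1,
        T (face far0 c) s1 s01 & T (face far1 c) s0 s01].

Definition compatible n (c : X n) (sigma : face_map 0 n -> S) : Prop :=
  (forall k, q (sigma k) = face k c) /\
  (forall j : face_map 1 n,
     T (face j c) (sigma (face_comp j (corner 1))) (sigma (face_comp j tip))).

(* A cube of the cover is a cube of X with a compatible choice of states at its
   corners. *)
Definition cover_cube n : Type :=
  {z : X n * (face_map 0 n -> S) | compatible z.1 z.2}.

Lemma cover_cube_eq n (z z' : cover_cube n) :
  (sval z).1 = (sval z').1 -> (forall k, (sval z).2 k = (sval z').2 k) -> z = z'.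
Proof.
case: z z' => [[c s] zP] [[c' s'] z'P] /= cc' ss'.
have e : s = s' by apply: functional_extensionality.
by subst; rewrite (proof_irrelevance _ zP z'P).
Qed.

Lemma compatible_face m n (f : face_map m n) c sigma :
  @compatible n c sigma ->
  compatible (face f c) (fun k => sigma (face_comp f k)).
Proof.
move=> [c0 c1]; split=> [k|j]; first by rewrite c0 faceC.
by have := c1 (face_comp f j); rewrite faceC !face_comp_assoc.
Qed.

Definition cover_face m n (f : face_map m n) (z : cover_cube n) : cover_cube m :=
  exist _ (face f (sval z).1, fun k => (sval z).2 (face_comp f k))
    (compatible_face f (svalP z)).

Lemma cover_face_1 n (z : cover_cube n) : cover_face (face_id n) z = z.
Proof.
by apply: cover_cube_eq => [|k] /=; rewrite ?face_1 ?face_id_comp.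
Qed.

Lemma cover_face_c m n p (f : face_map m n) (g : face_map p m) (z : cover_cube n) :
  cover_face (face_comp f g) z = cover_face g (cover_face f z).
Proof.
by apply: cover_cube_eq => [|k] /=; rewrite ?face_c ?face_comp_assoc.
Qed.

Lemma cover_face_free n (f : face_map n n) (z : cover_cube n) :
  cover_face f z = z -> f = face_id n.
Proof. by move=> /(congr1 (fun z => (sval z).1))/face_free. Qed.

Definition monodromy_cover : cube_complex :=
  CubeComplex cover_face_1 cover_face_c cover_face_free.

Definition cover_proj : cmap monodromy_cover X :=
  @CMap monodromy_cover X (fun n z => (sval z).1) (fun m n f z => erefl).

(** The label of the base corner, which together with the projection determines the whole cube
    ([cover_eq]). *)
Definition state n (z : monodromy_cover n) : S := (sval z).2 (corner n).

Lemma state_base n (z : monodromy_cover n) : state (base z) = state z.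
Proof.
rewrite /state /=; congr ((sval z).2 _).
by apply: face_map_eq => j; rewrite !faceE.
Qed.

Lemma q_state n (z : monodromy_cover n) : q (state z) = base (cover_proj _ z).
Proof. by case: z => [[c s] [c0 c1]]; apply: c0. Qed.

Lemma T_state (E : monodromy_cover 1) :
  T (cover_proj _ E) (state E) (state (rev_edge E)).
Proof.
case: E => [[c s] [c0 c1]] /=; have := c1 (face_id 1).
by rewrite face_1 !face_id_comp.
Qed.

Section Lift.

Variables (n : nat) (c : X n) (s : S).
Hypothesis qs : q s = base c.

Definition trans (e : X 1) (t : S) : S :=
  epsilon (inhabits t) (fun t' => T e t t').

Lemma transP e t : q t = init e -> T e t (trans e t).
Proof. by move=> /T_ex H; apply: epsilon_spec. Qed.

Definition trunc (k : nat) (b : 'I_n -> bool) : 'I_n -> bool :=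
  fun i => b i && (i < k).

(** The label of corner [b], transported from the base corner through the coordinates in increasing
    order. After [k] steps the path is at corner [trunc k b]; for [k] beyond [n], [insub] fails and
    the path stops. *)
Fixpoint walk (b : 'I_n -> bool) (k : nat) : S :=
  if k is k'.+1 then
    if insub k' is Some i then
      if b i then trans (face (edge_at (trunc k' b) i) c) (walk b k')
      else walk b k'
    else walk b k'
  else s.

Lemma vert_eq (b b' : 'I_n -> bool) : b =1 b' -> vert b = vert b'.
Proof. by move=> bb'; apply: face_map_eq => j; rewrite !faceE bb'. Qed.

Lemma edge_at_eq (b b' : 'I_n -> bool) i :
  (forall j, j != i -> b j = b' j) -> edge_at b i = edge_at b' i.
Proof.
move=> bb'; apply: face_map_eq => j; rewrite !faceE.
by case: eqP => // /eqP/bb'->.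
Qed.

Lemma trunc_upd_false k b (i : 'I_n) :
  i = k :> nat -> upd (trunc k b) i false =1 trunc k b.
Proof.
by move=> ik j; rewrite /upd /trunc; case: eqP => // ->; rewrite ik ltnn andbF.
Qed.

Lemma trunc_S k b (i : 'I_n) :
  i = k :> nat -> trunc k.+1 b =1 upd (trunc k b) i (b i).
Proof.
move=> ik j; rewrite /upd /trunc ltnS leq_eqVlt -ik; case: (j =P i) => [->|/eqP ji].
  by rewrite eqxx andbT.
by rewrite (negPf ji : (j == i :> nat) = false).
Qed.

Lemma trunc_big k b : n <= k -> trunc k b =1 b.
Proof. by move=> nk j; rewrite /trunc (leq_trans (ltn_ord j) nk) andbT. Qed.

Lemma q_walk b k : q (walk b k) = face (vert (trunc k b)) c.
Proof.
elim: k => [|k IHk] /=.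
  rewrite qs /base; congr face; apply: face_map_eq => j.
  by rewrite !faceE /trunc andbF.
case: insubP => [i _ ik|/negP nk]; last first.
  rewrite IHk; congr face; apply: vert_eq => j.
  have nk' : n <= k by rewrite leqNgt; apply/negP.
  by rewrite !trunc_big // ltnW.
case bi: (b i).
  have qi : q (walk b k) = init (face (edge_at (trunc k b) i) c).
    rewrite IHk /init /base faceC edge_at_init; congr face; apply: vert_eq => j.
    by rewrite trunc_upd_false.
  have /T_rev/T_init-> := transP qi.
  rewrite init_rev term_tip faceC edge_at_tip; congr face; apply: vert_eq => j.
  by rewrite (trunc_S b ik) bi.
rewrite IHk; congr face; apply: vert_eq => j.
by rewrite (trunc_S b ik) bi trunc_upd_false.
Qed.

Lemma walk_eq b b' k :
  (forall i : 'I_n, i < k -> b i = b' i) -> walk b k = walk b' k.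
Proof.
elim: k => [//|k IHk] bb' /=.
rewrite IHk => [|i ik]; last by apply: bb'; rewrite ltnW.
case: insubP => [i _ ik|//]; rewrite bb' ?ik //.
rewrite (@edge_at_eq (trunc k b) (trunc k b')) // => j ji.
by rewrite /trunc; case: ltnP => [jk|]; rewrite ?andbF // bb' // ltnW.
Qed.

Lemma T_edges (b : 'I_n -> bool) (i i' : 'I_n) t : i != i' -> b i = false -> b i' = false ->
  q t = face (vert b) c ->
  exists t0 t1 t01,
    [/\ T (face (edge_at b i) c) t t0, T (face (edge_at b i') c) t t1,
        T (face (edge_at (upd b i' true) i) c) t1 t01
      & T (face (edge_at (upd b i true) i') c) t0 t01].
Proof.
move=> ii' bi bi' qt; have [|t0 [t1 [t01 [H0 H1 H2 H3]]]] := @T_square (face (square_at b ii') c) t.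
  rewrite qt /base faceC; congr face; apply: face_map_eq => j; rewrite !faceE.
  by case: eqP => [->|_] /=; [|case: eqP => [->|_] //=]; rewrite ?faceE ?bi ?bi'.
exists t0, t1, t01; rewrite !faceC in H0 H1 H2 H3.
have i'i : (i' == i) = false by rewrite eq_sym (negPf ii').
have cases j : [\/ j = i, j = i' | (j == i) = false /\ (j == i') = false].
  by case: (j =P i) => [->|_]; [constructor 1|case: eqP => [->|_]; [constructor 2|constructor 3]].
split.
- move: H0; congr T; congr face; apply: face_map_eq => j; rewrite !faceE.
  by case: (cases j) => [->|->|[-> ->]]; rewrite ?eqxx ?i'i /= ?faceE //= bi'.
- move: H1; congr T; congr face; apply: face_map_eq => j; rewrite !faceE.
  by case: (cases j) => [->|->|[-> ->]]; rewrite ?eqxx ?i'i ?(negPf ii') /= ?faceE //= bi.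
- move: H2; congr T; congr face; apply: face_map_eq => j; rewrite !faceE /upd.
  by case: (cases j) => [->|->|[-> ->]]; rewrite ?eqxx ?i'i ?(negPf ii') /= ?faceE.
- move: H3; congr T; congr face; apply: face_map_eq => j; rewrite !faceE /upd.
  by case: (cases j) => [->|->|[-> ->]]; rewrite ?eqxx ?i'i ?(negPf ii') /= ?faceE.
Qed.

(** The two walks agree up to coordinate [i], where the second one takes the extra edge. Each later
    step in a direction [i'] pushes this edge across the square in directions [i] and [i'], which is
    where [T_square] is used. *)
Lemma T_walk b (i : 'I_n) k : b i = false -> i < k ->
  T (face (edge_at (trunc k b) i) c) (walk b k) (walk (upd b i true) k).
Proof.
move=> bi; elim: k => [//|k IHk]; rewrite ltnS leq_eqVlt => /orP[/eqP ik|ik].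
  rewrite /= -ik; case: insubP => [i' _ /val_inj->|]; last by rewrite ltn_ord.
  have bi1 : upd b i true i = true by rewrite /upd eqxx.
  rewrite bi bi1.
  have <- : walk b i = walk (upd b i true) i.
    by apply: walk_eq => j ji; rewrite /upd; case: eqP ji => // ->; rewrite ltnn.
  rewrite (@edge_at_eq (trunc i.+1 b) (trunc i (upd b i true))); last first.
    move=> j ji; rewrite (trunc_S b (erefl : i = i :> nat)) /upd /trunc (negPf ji).
    by [].
  apply: transP; rewrite q_walk /init /base faceC edge_at_init.
  congr face; apply: vert_eq => j; rewrite /upd /trunc.
  by case: eqP => // ->; rewrite bi.
have {}IHk := IHk ik.
rewrite /=; case: insubP => [i' _ i'k|nk]; last first.
  have nk' : n <= k by rewrite leqNgt.
  move: IHk; congr T; congr face; apply: edge_at_eq => j ji.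
  by rewrite !trunc_big // ltnW.
have i'i : i' != i by apply/eqP => e; rewrite -e i'k ltnn in ik.
have -> : upd b i true i' = b i' by rewrite /upd (negPf i'i).
case bi': (b i'); last first.
  move: IHk; congr T; congr face; apply: edge_at_eq => j ji.
  by rewrite (trunc_S b i'k) /upd bi'; case: eqP => // ->; rewrite /trunc bi'.
have qw : q (walk b k) = face (vert (trunc k b)) c by apply: q_walk.
have ti : trunc k b i = false by rewrite /trunc bi.
have ti' : trunc k b i' = false by rewrite /trunc i'k ltnn andbF.
have ii' : i != i' by rewrite eq_sym.
have [t0 [t1 [t01 [H0 H1 H2 H3]]]] := T_edges ii' ti ti' qw.
have e0 := T_fun H0 IHk; subst t0.
have /transP/T_fun/(_ H1)-> : q (walk b k) = init (face (edge_at (trunc k b) i') c).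
  exact: T_init H1.
have -> : trunc k (upd b i true) = upd (trunc k b) i true.
  apply: functional_extensionality => j; rewrite /trunc /upd.
  by case: (j =P i) => [->|].
have /transP/T_fun/(_ H3)-> := T_init H3.
move: H2; congr T; congr face; apply: edge_at_eq => j ji.
by rewrite (trunc_S b i'k) bi'.
Qed.

Lemma compatible_walk : compatible c (fun k => walk (bits k) n).
Proof.
split=> [k|j].
  rewrite q_walk -[in RHS](vert_bits k); congr face; apply: vert_eq => i.
  by rewrite trunc_big.
have bitsE b : bits (@vert n b) = b.
  by apply: functional_extensionality => i; rewrite /bits faceE; case: (b i).
have H b i : T (face (edge_at b i) c) (walk (upd b i false) n) (walk (upd b i true) n).
  have e : upd (upd b i false) i true = upd b i true.
    by apply: functional_extensionality => i'; rewrite /upd; case: eqP.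
  have := @T_walk (upd b i false) i n; rewrite e {1}/upd eqxx => /(_ erefl (ltn_ord i)).
  congr T; congr face; apply: edge_at_eq => i' i'i.
  by rewrite trunc_big // /upd (negPf i'i).
have [b [i [->|->]]] := edge_mapP' j.
  by rewrite edge_at_init edge_at_tip !bitsE.
rewrite !face_comp_assoc flip_tip -/tip edge_at_init edge_at_tip !bitsE -faceC.
exact: T_rev.
Qed.

Lemma compatible_unique sigma : compatible c sigma -> sigma (corner n) = s ->
  forall k, sigma k = walk (bits k) n.
Proof.
move=> [c0 c1] cs k.
suff H b m : sigma (vert (trunc m b)) = walk b m.
  by rewrite -H -[in LHS](vert_bits k); congr sigma; apply: vert_eq => i; rewrite trunc_big.
elim: m => [|m IHm] /=.
  rewrite -cs; congr sigma; apply: face_map_eq => j.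
  by rewrite !faceE /trunc andbF.
case: insubP => [i _ im|nm]; last first.
  have nm' : n <= m by rewrite leqNgt.
  by rewrite -IHm; congr sigma; apply: vert_eq => j; rewrite !trunc_big // ltnW.
case bi: (b i); last first.
  rewrite -IHm; congr sigma; apply: vert_eq => j.
  by rewrite (trunc_S b im) bi trunc_upd_false.
have := c1 (edge_at (trunc m b) i).
rewrite edge_at_init edge_at_tip (vert_eq (trunc_upd_false b im)) IHm.
have -> : vert (upd (trunc m b) i true) = vert (trunc m.+1 b).
  by apply: vert_eq => j; rewrite (trunc_S b im) bi.
by move=> H; have /transP/(T_fun H) := T_init H.
Qed.

End Lift.

Lemma cover_lift n (c : X n) s : q s = base c ->
  exists z : monodromy_cover n, state z = s /\ cover_proj _ z = c.
Proof.
move=> qs.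
exists (exist _ (c, fun k => walk c s (bits k) n) (compatible_walk qs)); split=> //.
rewrite /state /= (@walk_eq _ _ _ _ (fun _ => false)); last first.
  by move=> i _; rewrite /bits faceE.
have H m : walk c s (fun _ => false) m = s by elim: m => //= m ->; case: insub.
exact: H.
Qed.

Lemma cover_eq n (z z' : monodromy_cover n) :
  cover_proj _ z = cover_proj _ z' -> state z = state z' -> z = z'.
Proof.
case: z z' => [[c f] zP] [[c' f'] z'P]; rewrite /state /= => cc' ff'; subst c'.
apply: cover_cube_eq => //= k.
exact: etrans (compatible_unique zP ff' k) (esym (compatible_unique z'P erefl k)).
Qed.

Hypothesis q_surj : forall x, exists s, q s = x.

Lemma cover_covering : covering cover_proj.
Proof.
split=> [x|y n c cy].
  have [s sx] := q_surj x.
  have [|z [_ zx]] := @cover_lift 0 x s; first by rewrite base0.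
  by exists z.
have [|z [zs zc]] := @cover_lift n c (state y).
  by rewrite q_state base0 cy.
exists z; split=> [|z' [z'y z'c]].
  split=> //; apply: cover_eq; last by rewrite state_base.
  by rewrite -cy -zc cmap_base.
by apply: cover_eq; [rewrite zc | rewrite zs -z'y state_base].
Qed.

Lemma cover_edge e s s' : T e s s' ->
  exists E : monodromy_cover 1, [/\ cover_proj _ E = e, state E = s & state (rev_edge E) = s'].
Proof.
move=> Te; have [E [Es Ee]] := cover_lift (T_init Te); exists E; split=> //.
by apply: T_fun Te; rewrite -Es -Ee; apply: T_state.
Qed.

End Cover.

(** * Nonpositive curvature passes to covers *)

Section CoveringNpc.

Variables (X Y : cube_complex) (p : cmap Y X).
Hypothesis p_cov : covering p.

Lemma covering_inj n (c c' : Y n) : base c = base c' -> p _ c = p _ c' -> c = c'.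
Proof.
move=> bc pc; have [_ /(_ (base c) n (p _ c))[]] := p_cov; first by rewrite cmap_base.
by move=> z [_ zU]; rewrite -(zU c) ?(zU c').
Qed.

Lemma covering_lift (y : Y 0) n (c : X n) : base c = p _ y ->
  exists c', base c' = y /\ p _ c' = c.
Proof. by move=> cy; have [_ /(_ y n c cy)[c' [H _]]] := p_cov; exists c'. Qed.

Lemma consecutive_cmap (A B : cube_complex) (f : cmap A B) (a b : A 1) :
  consecutive a b -> consecutive (f _ a) (f _ b).
Proof. by case=> s [<- <-]; exists (f _ s); rewrite !cmap_face. Qed.

Lemma covering_npc : nonpositively_curved X -> nonpositively_curved Y.
Proof.
move=> Xn y; have [[X1 X2] X3] := Xn (p _ y); split; first split.
- move=> n c cy i j ij; apply: (X1 n (p _ c)); first by rewrite -cmap_base cy.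
  by rewrite -!cmap_face ij.
- move=> n c c' cy c'y cc'; apply: covering_inj; first by rewrite cy.
  apply: X2 => [||i]; rewrite -?cmap_base ?cy ?c'y //.
  by rewrite -!cmap_face cc'.
- move=> n e ey ee.
  have [i||c [cy ce]] := X3 n (fun i => p _ (e i)).
  + by rewrite -cmap_init ey.
  + move=> i j ij; have [Nij Cij] := ee i j ij; split; last exact: consecutive_cmap.
    by move=> H; apply: Nij; apply: covering_inj H; rewrite -!/(init _) !ey.
  + have [c' [c'y pc']] := covering_lift cy; exists c'; split=> // i.
    apply: covering_inj; first by rewrite -!/(init _) base_axis c'y ey.
    by rewrite cmap_face pc' ce.
Qed.

End CoveringNpc.

(** * Specialness in terms of parallel edges *)

Section Parallel.

Variable X : cube_complex.
Implicit Types (a b e : X 1).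

Lemma parallel_rev a b : parallel a b -> parallel (rev_edge a) (rev_edge b).
Proof.
elim=> [{}a {}b [s [-> ->]]|{}a|{}a {}b _|{}a {}b c _ H1 _ H2]; last 3 first.
- exact: rst_refl.
- exact: rst_sym.
- exact: rst_trans H1 H2.
(* The reflection of the square in its first coordinate reverses both parallel sides. *)
have [f fE] : exists f : face_map 2 2, forall j, f j = inr (j, j == ord0).
  unshelve eexists (@mk_face 2 2 (fun j => inr (j, j == ord0)) _ _).
  - by move=> k; exists k.
  - by move=> j j' k /= [->] [->].
  by move=> j; rewrite ffunE.
apply: rst_step; exists (face f s); rewrite /rev_edge !faceC.
split; congr face; apply: face_map_eq => j; rewrite !faceE fE /= !faceE;
  by case: eqP => //= _; rewrite !faceE.
Qed.

(** Parallelism of undirected edges, equivalent to being dual to a common hyperplane by [dual_upar]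
    and [upar_dual]. *)
Definition upar a b : Prop := parallel a b \/ parallel a (rev_edge b).

Lemma upar_refl a : upar a a.
Proof. by left; apply: rst_refl. Qed.

Lemma upar_sym a b : upar a b -> upar b a.
Proof.
case=> H; [left|right]; first exact: rst_sym.
by apply: rst_sym; rewrite -[b]rev_edgeK; apply: parallel_rev.
Qed.

Lemma upar_rev a : upar a (rev_edge a).
Proof. by right; rewrite rev_edgeK; apply: rst_refl. Qed.

Lemma upar_trans a b c : upar a b -> upar b c -> upar a c.
Proof.
case=> H1 [] H2.
- by left; apply: rst_trans H2.
- by right; apply: rst_trans H2.
- by right; apply: rst_trans H1 (parallel_rev H2).
- by left; apply: rst_trans H1 _; rewrite -[c]rev_edgeK; apply: parallel_rev.
Qed.

(** The corners [trunc k b] interpolate between the base corner and [b]; passing from [k] to [k.+1]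
    changes at most one coordinate, hence moves the edge across one square. *)
Lemma edge_at_parallel n (c : X n) i (b : 'I_n -> bool) :
  parallel (face (edge_at b i) c) (face (axis i) c).
Proof.
have step (b' : 'I_n -> bool) j : j != i ->
    parallel (face (edge_at (upd b' j false) i) c) (face (edge_at (upd b' j true) i) c).
  move=> ji; have ij : i != j by rewrite eq_sym.
  apply: rst_step; exists (face (square_at b' ij) c); rewrite !faceC.
  split; congr face; apply: face_map_eq => k; rewrite !faceE /upd;
    case: (k =P i) => _ /=; rewrite ?faceE //;
    by case: (k =P j) => _ /=; rewrite ?faceE.
have H k : parallel (face (edge_at (trunc k b) i) c) (face (axis i) c).
  elim: k => [|k IHk].
    rewrite (_ : edge_at _ i = axis i); first exact: rst_refl.
    by apply: face_map_eq => j; rewrite !faceE /trunc andbF.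
  case: (ltnP k n) => [kn|nk]; last first.
    rewrite (@edge_at_eq _ _ (trunc k b)) // => j _.
    by rewrite !trunc_big // ltnW.
  have kE : Ordinal kn = k :> nat by [].
  apply: rst_trans IHk; case: (Ordinal kn =P i) => [ki|/eqP ki].
    rewrite (@edge_at_eq _ _ (trunc k b)); first exact: rst_refl.
    by move=> j ji; rewrite (trunc_S b kE) ki /upd (negPf ji).
  have S1 := step (trunc k b) _ ki.
  rewrite (@edge_at_eq _ (trunc k.+1 b) (upd (trunc k b) (Ordinal kn) (b (Ordinal kn)))); last first.
    by move=> j _; rewrite (trunc_S b kE).
  have -> : edge_at (trunc k b) i = edge_at (upd (trunc k b) (Ordinal kn) false) i.
    by apply: edge_at_eq => j _; rewrite trunc_upd_false.
  by case: (b _); [apply: rst_sym | apply: rst_refl].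
have := H n; rewrite (@edge_at_eq _ (trunc n b) b) // => j _.
by rewrite trunc_big.
Qed.

Lemma face_upar n (c : X n) i (g : face_map 1 n) :
  dir (g i) = Some ord0 -> upar (face g c) (face (axis i) c).
Proof.
move=> /edge_mapP[b [->|->]]; first by left; apply: edge_at_parallel.
right; rewrite -faceC; apply: parallel_rev; exact: edge_at_parallel.
Qed.

(** One dual edge is chosen in each midcube, which turns adjacency of midcubes into undirected
    parallelism. *)
Definition mid_edge (M : midcube X) : X 1 := face (axis (mid_dir M)) (mid_cube M).

Lemma midcube_upar M M' :
  clos_refl_sym_trans _ (@midcube_face X) M M' -> upar (mid_edge M) (mid_edge M').
Proof.
elim=> [{}M {}M' [f [cf df]]|{}M|{}M {}M' _|M1 M2 M3 _ H1 _ H2].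
- rewrite /mid_edge cf faceC; apply: face_upar.
  rewrite faceE dir_subst df /= faceE eqxx //.
- exact: upar_refl.
- exact: upar_sym.
- exact: upar_trans H1 H2.
Qed.

Lemma mid_edge0 e : mid_edge (MidCube e ord0) = e.
Proof.
rewrite /mid_edge /= -[RHS]face_1; congr face; apply: face_map_eq => j.
by rewrite !faceE (ord1 j).
Qed.

Definition hyp (a : X 1) (M : midcube X) : Prop :=
  clos_refl_sym_trans _ (@midcube_face X) (MidCube a ord0) M.

Lemma hyp_hyperplane a : hyperplane (hyp a).
Proof. by exists (MidCube a ord0). Qed.

Lemma dual_upar H a b : hyperplane H -> dual a H -> dual b H -> upar a b.
Proof.
move=> [M HM] /HM Ma /HM Mb; rewrite -[a]mid_edge0 -[b]mid_edge0.
by apply: midcube_upar; apply: rst_trans Mb; apply: rst_sym.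
Qed.

Lemma parallel_dual a b : parallel a b -> dual b (hyp a).
Proof.
elim=> [{}a {}b [s [-> ->]]|{}a|{}a {}b _|{}a {}b c _ H1 _ H2].
- apply: (rst_trans _ _ _ (MidCube s ord0)); last apply: rst_sym; apply: rst_step.
    by exists (side false); split=> //=; rewrite faceE.
  by exists (side true); split=> //=; rewrite faceE.
- exact: rst_refl.
- exact: rst_sym.
- exact: rst_trans H1 H2.
Qed.

Lemma dual_rev a : dual (rev_edge a) (hyp a).
Proof.
apply: rst_sym; apply: rst_step; by exists flip; split=> //=; rewrite faceE.
Qed.

Lemma upar_dual a b : upar a b -> dual b (hyp a).
Proof.
case=> H; first exact: parallel_dual.
apply: rst_trans (parallel_dual H) _.
by have := dual_rev (rev_edge b); rewrite rev_edgeK.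
Qed.

End Parallel.

(** Specialness without hyperplanes. [es_direct] combines the absence of direct self-osculation with
    that of self-crossing; [es_inter] says that crossing hyperplanes span a square at every vertex
    where they meet. *)
Record edge_special (X : cube_complex) : Prop := EdgeSpecial {
  es_cross : forall a b : X 1, consecutive a b -> ~ upar a b;
  es_sided : forall a : X 1, ~ parallel a (rev_edge a);
  es_direct : forall a b : X 1, parallel a b -> init a = init b -> a = b;
  es_inter : forall a b a' b' : X 1, consecutive a b -> upar a a' -> upar b b' ->
    init a' = init b' -> consecutive a' b'
}.

Lemma consecutive_init (X : cube_complex) (a b : X 1) :
  consecutive a b -> init a = init b.
Proof. by case=> s [<- <-]; rewrite !base_axis. Qed.

Lemma special_edges (X : cube_complex) : special X -> edge_special X.
Proof.
move=> [_ [Xc [Xs [Xd Xi]]]].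
have Xcross (a b : X 1) : consecutive a b -> ~ upar a b.
  move=> ab /upar_dual Hb; case: (Xc _ (hyp_hyperplane a)).
  exists (init a), a, b; split=> //; split; first by rewrite (consecutive_init ab).
  by split=> //; apply: rst_refl.
split=> // [a|a b ab iab|a b a' b' ab aa' bb' iab].
- exact: (Xs _ (hyp_hyperplane a) a (rst_refl _ _ _)).
- apply: NNPP => Nab; case: (classic (consecutive a b)) => [/Xcross|] Cab.
    by apply: Cab; left.
  case: (Xd _ (hyp_hyperplane a)); exists (init a), a, b; do ![split=> //].
    exact: rst_refl.
  exact: parallel_dual.
- apply: NNPP => Nab.
  case: (Xi _ _ (hyp_hyperplane a) (hyp_hyperplane b)); split.
    (* The two hyperplanes are distinct, as [inter_osculate] demands, since otherwise one would
       cross itself. *)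
    move=> e; apply: (@Xcross a b) => //; apply: upar_sym.
    apply: (dual_upar (hyp_hyperplane b)); first exact: rst_refl.
    by rewrite -e; apply: rst_refl.
  split.
    exists (init a), a, b; split=> //; split; first by rewrite (consecutive_init ab).
    by split; [apply: rst_refl|split=> //; apply: rst_refl].
  exists (init a'), a', b'; split=> //; split=> //.
  by split; [apply: upar_dual|split=> //; apply: upar_dual].
Qed.

Lemma edges_special (X : cube_complex) :
  nonpositively_curved X -> edge_special X -> special X.
Proof.
move=> Xn [Xc Xs Xd Xi]; split=> //; split; [|split; [|split]].
- move=> H HH [v [a [b [_ [_ [aH [bH ab]]]]]]].
  exact: Xc ab (dual_upar HH aH bH).
- by move=> H HH a _; apply: Xs.
- move=> H HH [v [a [b [av [bv [Nab [ab _]]]]]]]; apply: Nab.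
  by apply: Xd => //; rewrite bv.
- move=> H1 H2 HH1 HH2 [_ [[v [a [b [_ [_ [aH [bH ab]]]]]]] [w [a' [b' [aw [bw [a'H [b'H Nab]]]]]]]]].
  apply: Nab; apply: Xi ab _ _ _; last by rewrite bw.
    exact: dual_upar HH1 aH a'H.
  exact: dual_upar HH2 bH b'H.
Qed.

Lemma consecutive_sym (X : cube_complex) (a b : X 1) :
  consecutive a b -> consecutive b a.
Proof.
(* The symmetry exchanging the two coordinates of the square. *)
have [f fE] : exists f : face_map 2 2, forall j, f j = inr (rev_ord j, false).
  unshelve eexists (@mk_face 2 2 (fun j => inr (rev_ord j, false)) _ _).
  - by move=> k; exists (rev_ord k); rewrite /= rev_ordK.
  - by move=> j j' k /= [jk] [j'k]; apply: rev_ord_inj; rewrite jk j'k.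
  by move=> j; rewrite ffunE.
case=> s [<- <-]; exists (face f s); rewrite !faceC.
by split; congr face; apply: face_map_eq => -[[|[|j]] lj] //; rewrite !faceE fE /= !faceE.
Qed.

(** * Finiteness *)

(** Finiteness with repetitions allowed, so that no decidable equality is required. *)
Definition listable (A : Type) : Prop := exists l : list A, forall x, List.In x l.

Lemma listable_fibers (A B : Type) (f : A -> B) :
  listable B ->
  (forall b, exists l : list A, forall a, f a = b -> List.In a l) -> listable A.
Proof.
move=> [lB BP] fP.
suff [l lP] : exists l : list A, forall a, List.In (f a) lB -> List.In a l.
  by exists l => a; apply: lP.
elim: lB {BP} => [|b lB [l lP]]; first by exists nil.
have [lb lbP] := fP b; exists (lb ++ l)%list => a /= [e|/lP al];
  apply/List.in_or_app; [left; exact: lbP | by right].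
Qed.

Lemma listable_inj (A B : Type) (f : A -> B) :
  injective f -> listable B -> listable A.
Proof.
move=> fI fB; apply: (listable_fibers (f := f) fB) => b.
case: (classic (exists a, f a = b)) => [[a ab]|Nb].
  by exists (cons a nil) => a' a'b; left; apply: fI; rewrite ab a'b.
by exists nil => a ab; case: Nb; exists a.
Qed.

Lemma listable_prod (A B : Type) : listable A -> listable B -> listable (A * B).
Proof.
move=> fA [l lP]; apply: (listable_fibers (f := fst) fA) => a.
exists (List.map (pair a) l) => -[_ b] /= ->.
by apply: List.in_map.
Qed.

Lemma listable_sig (A : Type) (P : A -> Prop) : listable A -> listable {a | P a}.
Proof.
apply: (listable_inj (f := @proj1_sig A P)) => -[a aP] [b bP] /= ab.
by subst b; rewrite (proof_irrelevance _ aP bP).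
Qed.

Lemma listable_bool : listable bool.
Proof. by exists (cons true (cons false nil)) => -[]; [left|right; left]. Qed.

Lemma listable_fun (A B : Type) : listable A -> listable B -> listable (A -> B).
Proof.
move=> [lA AP] [lB BP].
(* Functions are enumerated up to agreement on an initial list of points, which permits induction on
   that list. *)
suff [L LP] : exists L : list (A -> B), forall f, exists g,
    List.In g L /\ forall a, List.In a lA -> f a = g a.
  exists L => f; have [g [gL fg]] := LP f.
  by rewrite (_ : f = g) //; apply: functional_extensionality => a; apply: fg.
elim: lA {AP} => [|a lA [L LP]].
  case: (classic (inhabited (A -> B))) => [[g]|N].
    by exists (cons g nil) => f; exists g; split; [left|].
  by exists nil => f; case: N.
pose ext b (g : A -> B) x := if excluded_middle_informative (x = a) then b else g x.
exists (List.flat_map (fun b => List.map (ext b) L) lB) => f.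
have [g [gL fg]] := LP f; exists (ext (f a) g); split.
  by apply/List.in_flat_map; exists (f a); split=> //; apply: List.in_map.
move=> x; rewrite /ext; case: excluded_middle_informative => [xa|xa]; first by rewrite /= xa.
by case=> [ax|/fg//]; case: xa.
Qed.

(** * Completing a local isometry *)

Section LocalIsometry.

Variables (Y Z : cube_complex) (f : cmap Y Z).
Hypothesis f_iso : local_isometry f.

Lemma local_isometry_inj (e e' : Y 1) : init e = init e' -> f _ e = f _ e' -> e = e'.
Proof. by move=> ee'; have [H _] := f_iso (init e); apply: H. Qed.

Lemma local_isometry_square (a b : Y 1) (c : Z 2) : init a = init b ->
  face (axis ord0) c = f _ a -> face (axis ord_max) c = f _ b ->
  exists s : Y 2, [/\ f _ s = c, face (axis ord0) s = a & face (axis ord_max) s = b].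
Proof.
move=> ab ca cb; have [_ /(_ 2 c)[||s [sb sc]]] := f_iso (init a).
- by rewrite -(base_axis ord0) ca cmap_init.
- case=> -[|[|i]] li //.
    by exists a; split=> //; rewrite -ca; congr (face (axis _) c); apply: val_inj.
  by exists b; split=> //; rewrite -cb; congr (face (axis _) c); apply: val_inj.
exists s; split=> //; apply: local_isometry_inj.
- by rewrite base_axis sb.
- by rewrite cmap_face sc.
- by rewrite base_axis sb ab.
- by rewrite cmap_face sc.
Qed.

End LocalIsometry.

Section SquareFaces.

Variables (X : cube_complex) (c : X 2).

Lemma init_far0 : init (face far0 c) = term (face (axis ord_max) c).
Proof.
rewrite term_tip /init /base !faceC; congr face; apply: face_map_eq => j.
by rewrite !faceE; case: j => -[|[|j]] lj //=; rewrite !(faceE, tipE).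
Qed.

Lemma init_far1 : init (face far1 c) = term (face (axis ord0) c).
Proof.
rewrite term_tip /init /base !faceC; congr face; apply: face_map_eq => j.
by rewrite !faceE; case: j => -[|[|j]] lj //=; rewrite !(faceE, tipE).
Qed.

Lemma term_far : term (face far0 c) = term (face far1 c).
Proof.
rewrite !term_tip !faceC; congr face; apply: face_map_eq => j.
by rewrite !faceE; case: j => -[|[|j]] lj //=; rewrite !(faceE, tipE).
Qed.

Lemma parallel_far0 : parallel (face far0 c) (face (axis ord0) c).
Proof. exact: edge_at_parallel. Qed.

Lemma parallel_far1 : parallel (face far1 c) (face (axis ord_max) c).
Proof. exact: edge_at_parallel. Qed.

Lemma consecutive_axis : consecutive (face (axis ord0) c) (face (axis ord_max) c).
Proof. by exists c. Qed.

End SquareFaces.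

(** * Commuting permutations from parallelism classes *)

Section Completion.

Variables (Y Z : cube_complex) (f : cmap Y Z).
Hypotheses (f_iso : local_isometry f) (Zs : edge_special Z).

Definition step (a : Z 1) (y y' : Y 0) : Prop :=
  exists e : Y 1, [/\ init e = y, term e = y' & parallel (f _ e) a].

(** The images of the two edges are parallel and start at the same vertex, so they coincide because
    Z has no direct self-osculation; local injectivity of [f] does the rest. *)
Lemma step_fun a y y1 y2 : step a y y1 -> step a y y2 -> y1 = y2.
Proof.
move=> [e [ey <- ea]] [e' [e'y <- e'a]]; congr (term _).
apply: (local_isometry_inj f_iso); first by rewrite ey.
apply: (es_direct Zs); last by rewrite -!cmap_init ey e'y.
by apply: rst_trans ea _; apply: rst_sym.
Qed.

Lemma step_rev a y y' : step a y y' -> step (rev_edge a) y' y.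
Proof.
move=> [e [<- <- ea]]; exists (rev_edge e); split; rewrite ?term_rev //.
by rewrite cmap_rev; apply: parallel_rev.
Qed.

Lemma step_par a b y y' : parallel a b -> step a y y' -> step b y y'.
Proof.
by move=> ab [e [ey ey' ea]]; exists e; split=> //; apply: rst_trans ea ab.
Qed.

Definition crosses (a b : Z 1) : Prop :=
  exists a' b', [/\ upar a' a, upar b' b & consecutive a' b'].

Lemma crosses_sym a b : crosses a b -> crosses b a.
Proof.
by move=> [a' [b' [aa' bb' /consecutive_sym ab]]]; exists b', a'.
Qed.

Lemma crosses_upar a a1 b b1 : upar a a1 -> upar b b1 -> crosses a b -> crosses a1 b1.
Proof.
move=> aa1 bb1 [a' [b' [aa' bb' ab]]]; exists a', b'; split=> //.
  exact: upar_trans aa' aa1.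
exact: upar_trans bb' bb1.
Qed.

Lemma crosses_upar_neq a b : crosses a b -> ~ upar a b.
Proof.
move=> [a' [b' [aa' bb' /(es_cross Zs) N]]] ab; apply: N.
exact: upar_trans (upar_trans aa' ab) (upar_sym bb').
Qed.

Lemma crosses_rev a b : crosses a b -> crosses a (rev_edge b).
Proof. apply: crosses_upar; [exact: upar_refl|exact: upar_rev]. Qed.

(** The images of the two edges start at a common vertex and lie on crossing hyperplanes, so they
    span a square of Z because there is no inter-osculation. Fullness of the link image lifts this
    square to Y, and its far corner is [y3]. *)
Lemma step_square a b y y1 y2 : crosses a b -> step a y y1 -> step b y y2 ->
  exists y3, step b y1 y3 /\ step a y2 y3.
Proof.
move=> [a' [b' [aa' bb' ab]]] [e [ey ey1 ea]] [e' [e'y e'y2 eb]].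
have [|||s [s0 s1]] := es_inter Zs ab (a' := f _ e) (b' := f _ e').
- by apply: upar_trans aa' _; apply: upar_sym; left.
- by apply: upar_trans bb' _; apply: upar_sym; left.
- by rewrite -!cmap_init ey e'y.
have [|c [fc c0 c1]] := local_isometry_square f_iso _ s0 s1; first by rewrite ey.
exists (term (face far0 c)); split; [exists (face far1 c)|exists (face far0 c)].
  rewrite init_far1 term_far c0; split=> //; rewrite cmap_face fc.
  by apply: rst_trans (parallel_far1 _) _; rewrite s1.
rewrite init_far0 c1; split=> //; rewrite cmap_face fc.
by apply: rst_trans (parallel_far0 _) _; rewrite s0.
Qed.

(* An arbitrary representative of the hyperplane dual to [a] *)
Definition wall (a : Z 1) : Z 1 := epsilon (inhabits a) (upar a).

Lemma wall_upar a : upar a (wall a).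
Proof. by apply: epsilon_spec; exists a; apply: upar_refl. Qed.

Lemma wall_eq a b : upar a b -> wall a = wall b.
Proof.
move=> ab; rewrite /wall (_ : upar a = upar b).
  by apply: epsilon_inh_irrelevance; exists b; apply: upar_refl.
apply: functional_extensionality => c; apply: propositional_extensionality.
by split; apply: upar_trans => //; apply: upar_sym.
Qed.

(* The partial bijection [step a] is completed to a permutation of
   [Y 0 * (Z 1 -> bool)]: a sign is kept for each hyperplane of Z, edges are
   followed backwards along the hyperplanes whose sign is [true], and the sign
   changes where there is no edge to follow. *)
Definition cpoint : Type := (Y 0 * (Z 1 -> bool))%type.

Definition sgn (a : Z 1) (x : cpoint) : Z 1 :=
  if x.2 (wall a) then rev_edge a else a.

Definition switch (a : Z 1) (s : Z 1 -> bool) : Z 1 -> bool :=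
  fun b => if excluded_middle_informative (b = wall a) then ~~ s b else s b.

(** This is the predicate [N] of [completion]. The genuine edge may be followed in either direction,
    according to the sign. *)
Definition moves (a : Z 1) (x : cpoint) : Prop := exists y', step (sgn a x) x.1 y'.

Definition shift (a : Z 1) (x x' : cpoint) : Prop :=
  (step (sgn a x) x.1 x'.1 /\ x'.2 = x.2) \/
  [/\ ~ moves a x, x'.1 = x.1 & x'.2 = switch a x.2].

Lemma switch_wall a s : switch a s (wall a) = ~~ s (wall a).
Proof. by rewrite /switch; case: excluded_middle_informative. Qed.

Lemma switch_neq a b s : ~ upar a b -> switch a s (wall b) = s (wall b).
Proof.
move=> Nab; rewrite /switch; case: excluded_middle_informative => // e.
case: Nab; apply: upar_trans (wall_upar a) _; rewrite -e.
exact: upar_sym (wall_upar b).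
Qed.

Lemma switchK a s : switch a (switch a s) = s.
Proof.
apply: functional_extensionality => b; rewrite /switch.
by case: excluded_middle_informative => //= ?; rewrite negbK.
Qed.

Lemma switch_comm a b s : switch a (switch b s) = switch b (switch a s).
Proof.
apply: functional_extensionality => c; rewrite /switch.
by case: excluded_middle_informative => /= ?; case: excluded_middle_informative.
Qed.

Lemma switch_upar a b s : upar a b -> switch a s = switch b s.
Proof. by move=> /wall_eq ab; rewrite /switch ab. Qed.

Lemma sgn_rev a x : sgn (rev_edge a) x = rev_edge (sgn a x).
Proof.
rewrite /sgn -(wall_eq (upar_rev a)).
by case: (x.2 _); rewrite // rev_edgeK.
Qed.

Lemma sgn_switch a y s : sgn a (y, switch a s) = rev_edge (sgn a (y, s)).
Proof.
rewrite /sgn /= switch_wall; case: (s _) => //=.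
by rewrite rev_edgeK.
Qed.

Lemma sgn_upar a x : upar a (sgn a x).
Proof. by rewrite /sgn; case: (x.2 _); [apply: upar_rev|apply: upar_refl]. Qed.

Lemma sgn_par a b x : parallel a b -> parallel (sgn a x) (sgn b x).
Proof.
move=> ab; rewrite /sgn (wall_eq (or_introl ab)).
by case: (x.2 _) => //; apply: parallel_rev.
Qed.

Lemma moves_par a b x : parallel a b -> moves a x -> moves b x.
Proof. by move=> ab [y xy]; exists y; apply: step_par xy; apply: sgn_par. Qed.

Lemma shift_ex a x : exists x', shift a x x'.
Proof.
case: (classic (moves a x)) => [[y xy]|N]; first by exists (y, x.2); left.
by exists (x.1, switch a x.2); right.
Qed.

Lemma shift_fun a x x1 x2 : shift a x x1 -> shift a x x2 -> x1 = x2.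
Proof.
case: x1 x2 => [y1 s1] [y2 s2].
case=> /= [[xy1 ->]|[N -> ->]]; case=> /= [[xy2 ->]|[N' -> ->]] //.
- by rewrite (step_fun xy1 xy2).
- by case: N'; exists y1.
- by case: N; exists y2.
Qed.

(** Where [a] is stuck, flipping the sign makes [rev_edge a] look for the same directed edge as
    before; it is stuck too and flips the sign back. *)
Lemma shift_rev a x x' : shift a x x' -> shift (rev_edge a) x' x.
Proof.
case: x x' => [y s] [y' s']; case=> /= [[yy' ->]|[N -> ->]]; [left|right].
  by split=> //; rewrite sgn_rev; apply: step_rev.
split=> //; last by rewrite -(switch_upar _ (upar_rev a)) switchK.
move=> [y1]; rewrite sgn_rev sgn_switch rev_edgeK => H; apply: N.
by exists y1.
Qed.

Lemma shift_par a b x x' : parallel a b -> shift a x x' -> shift b x x'.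
Proof.
move=> ab; case=> [[H e]|[N e1 e2]]; [left|right].
  by split=> //; apply: step_par H; apply: sgn_par.
split=> //; last by rewrite e2; apply: switch_upar; left.
by move=> H; apply: N; apply: moves_par H; apply: rst_sym.
Qed.

Lemma sgn_shift a b x x' : crosses a b -> shift b x x' -> sgn a x' = sgn a x.
Proof.
move=> ab; rewrite /sgn; case=> [[_ ->]//|[_ _ ->]].
by rewrite switch_neq // => /upar_sym; apply: crosses_upar_neq.
Qed.

Lemma crosses_sgn a b x : crosses a b -> crosses (sgn a x) (sgn b x).
Proof. by apply: crosses_upar; apply: sgn_upar. Qed.

Lemma moves_shift_imp a b x x' : crosses a b -> shift b x x' -> moves a x -> moves a x'.
Proof.
move=> ab H [y xy]; have := sgn_shift ab H; rewrite /moves => ->.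
case: H => [[xx' _]|[_ -> _]]; last by exists y.
have [y' [_ H]] := step_square (crosses_sgn x ab) xy xx'.
by exists y'.
Qed.

Lemma moves_shift a b x x' : crosses a b -> shift b x x' -> moves a x <-> moves a x'.
Proof.
move=> ab H; split; first exact: moves_shift_imp ab H.
by apply: moves_shift_imp (shift_rev H); apply: crosses_rev.
Qed.

(** Crossing hyperplanes have different walls, so neither shift alters the sign read by the other,
    nor whether the other is stuck. Two genuine moves close up by [step_square]; a sign change
    commutes with everything else. *)
Lemma shift_square a b x x1 x2 : crosses a b -> shift a x x1 -> shift b x x2 ->
  exists x3, shift b x1 x3 /\ shift a x2 x3.
Proof.
move=> ab H1 H2; have ba := crosses_sym ab.
have e1 := sgn_shift ba H1; have e2 := sgn_shift ab H2.
have N1 := moves_shift ba H1; have N2 := moves_shift ab H2.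
case: x x1 x2 H1 H2 e1 e2 N1 N2 => [y s] [y1 s1] [y2 s2].
case=> /= [[yy1 ->]|[Na -> ->]]; case=> /= [[yy2 ->]|[Nb -> ->]] e1 e2 N1 N2.
- have [y3 [y13 y23]] := step_square (crosses_sgn (y, s) ab) yy1 yy2.
  by exists (y3, s); split; left; rewrite /= ?e1 ?e2.
- exists (y1, switch b s); split; [right|left]; rewrite /= ?e2 //.
  by split=> // /N1.
- exists (y2, switch a s); split; [left|right]; rewrite /= ?e1 //.
  by split=> // /N2.
- exists (y, switch a (switch b s)); split; right; split=> //.
  + by move=> /N1.
  + exact: switch_comm.
  + by move=> /N2.
Qed.

Definition perm (a : Z 1) (x : cpoint) : cpoint := epsilon (inhabits x) (shift a x).

Lemma permP a x : shift a x (perm a x).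
Proof. by apply: epsilon_spec; apply: shift_ex. Qed.

Lemma permE a x x' : shift a x x' -> perm a x = x'.
Proof. by apply: shift_fun; apply: permP. Qed.

Lemma completion : listable (Y 0) -> listable (Z 1) ->
  exists (F : Type) (p : Z 1 -> F -> F) (N : Z 1 -> F -> Prop) (i : Y 0 -> F),
    (listable F /\ injective i) /\
    [/\ forall a b x, parallel a b -> p a x = p b x,
        forall a x, p (rev_edge a) (p a x) = x
      & forall a b x, consecutive a b -> p a (p b x) = p b (p a x)] /\
    [/\ forall a b x, parallel a b -> N a x -> N b x,
        forall a b x, consecutive a b -> N a x <-> N a (p b x)
      & forall a x, N a x -> N (rev_edge a) (p a x)] /\
    (forall e : Y 1, p (f _ e) (i (init e)) = i (term e) /\ N (f _ e) (i (init e))) /\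
    (forall a y, N a (i y) -> init a = f _ y -> exists e, init e = y /\ f _ e = a).
Proof.
(* Y is embedded with all signs [false], where each [a] is followed forwards. *)
move=> Yf Zf; exists cpoint, perm, moves, (fun y => (y, fun _ => false)).
have crossesI a b : consecutive a b -> crosses a b.
  by move=> ab; exists a, b; split=> //; apply: upar_refl.
split; [|split; [|split; [|split]]].
- split; last by move=> y y' [].
  by apply: listable_prod => //; apply: listable_fun => //; apply: listable_bool.
- split=> [a b x ab|a x|a b x /crossesI ab].
  + by apply: permE; apply: shift_par (permP _ _); apply: rst_sym.
  + by apply: permE; apply: shift_rev; apply: permP.
  + have [x3 [x13 x23]] := shift_square ab (permP a x) (permP b x).
    by rewrite (permE x13) (permE x23).
- split=> [a b x|a b x /crossesI ab|a x].
  + exact: moves_par.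
  + exact: moves_shift ab (permP _ _).
  + move=> [y xy]; rewrite (@permE _ _ (y, x.2)); last by left.
    by exists x.1; rewrite sgn_rev; apply: step_rev.
- move=> e; have H : step (sgn (f _ e) (init e, fun _ => false)) (init e) (term e).
    by exists e; split=> //; apply: rst_refl.
  by split; [apply: permE; left | exists (term e)].
(* The edge that is followed lies over an edge parallel to [a] with the same initial vertex, hence
   over [a] itself. *)
- move=> a y [y' [e [ey _ ea]]] ay; exists e; split=> //.
  by apply: (es_direct Zs) ea _; rewrite -cmap_init ey.
Qed.

End Completion.

(** * Graphs of spaces with constant vertex space *)

(* The cube of Y x [0,1] over [y] with the direction of [0,1] in position [i],
   reversed when [s] is [true]. *)
Definition prism (Y : cube_complex) (s : bool) n (i : 'I_n.+1) (y : Y n) :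
    cylinder Y n.+1 :=
  existT (fun c : coord n.+1 => Y (base_dim c)) (inr (i, s)) y.

Lemma prism_face_level (Y : cube_complex) s m n (i : 'I_n.+1) (y : Y n)
    (g : face_map m n.+1) (g' : face_map m n) b :
  g i = inl b -> (forall l, g' l = g (lift i l)) ->
  face g (prism s i y) = level (s (+) b) (face g' y).
Proof.
move=> gi gg'; rewrite /= /cyl_face /=; apply: cyl_eq => [|l]; first by rewrite /= gi.
rewrite (@base_faceE _ _ g (inr (i, s)) l).
by rewrite /= gi gg'.
Qed.

Lemma prism_face_prism (Y : cube_complex) s m n (i : 'I_n.+1) (y : Y n)
    (g : face_map m.+1 n.+1) (g' : face_map m n) k t :
  g i = inr (k, t) -> (forall l, g' l = forget (inr (k, t)) (g (lift i l))) ->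
  face g (prism s i y) = prism (s (+) t) k (face g' y).
Proof.
move=> gi gg'; rewrite /= /cyl_face /=.
have e : subst_coord g (inr (i, s)) = inr (k, s (+) t) by rewrite /= gi.
apply: (cyl_eq _ e) => l.
rewrite (@base_faceE _ _ g (inr (i, s)) l).
by rewrite e gg' /=; case: (g _).
Qed.

(* X is covered, locally around each vertex, by "charts" B -> X, together with
   "strips" Y_j x [0,1] -> X joining two charts along a local isometry Y_j -> B. *)
Record chart_system (X B : cube_complex) : Type := ChartSystem {
  chart_index : Type;
  chart : chart_index -> cmap B X;
  strip_index : Type;
  strip_space : strip_index -> cube_complex;
  strip_map : forall j, cmap (strip_space j) B;
  strip : forall j, cmap (cylinder (strip_space j)) X;
  strip_end : strip_index -> bool -> chart_index;
  strip_level : forall j s n (y : strip_space j n),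
    strip j _ (level s y) = chart (strip_end j s) _ (strip_map j _ y);
  chart_inj : forall k n, injective (chart k n);
  chart_strip : forall k n (c : B n.+1) j s i (y : strip_space j n),
    chart k _ c <> strip j _ (prism s i y);
  chart_star : forall k b n (c : X n.+1), base c = chart k _ b ->
    (exists c', chart k _ c' = c) \/
    (exists j s i (y : strip_space j n),
       strip_end j s = k /\ strip j _ (prism s i y) = c);
  strip_inj : forall n j s i (y : strip_space j n) j' s' i' (y' : strip_space j' n),
    strip j _ (prism s i y) = strip j' _ (prism s' i' y') ->
    strip_end j s = strip_end j' s' ->
    existT (fun j => (bool * 'I_n.+1 * strip_space j n)%type) j (s, i, y) =
    existT _ j' (s', i', y');
  base_npc : nonpositively_curved B;
  strip_npc : forall j, nonpositively_curved (strip_space j);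
  strip_isometry : forall j, local_isometry (strip_map j)
}.

(** * Links in a complex made of charts and strips *)

Section ChartSystem.

Variables (X B : cube_complex) (C : chart_system X B).

Local Notation K := (chart_index C).
Local Notation J := (strip_index C).
Local Notation Y := (@strip_space _ _ C).
Local Notation beta := (@strip_map _ _ C).
Local Notation ends := (@strip_end _ _ C).
Implicit Types (k : K) (j : J) (s : bool).

Definition strip_cube j s n (i : 'I_n.+1) (y : Y j n) : X n.+1 :=
  strip j _ (prism s i y).

Definition strip_edge j s (y : Y j 0) : X 1 := strip_cube s ord0 y.

Lemma strip_base j s n i (y : Y j n) :
  base (strip_cube s i y) = chart (ends j s) _ (beta j _ (base y)).
Proof.
rewrite /base /strip_cube -cmap_face (@prism_face_level _ _ _ _ _ _ _ (corner n) false).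
- by rewrite addbF strip_level.
- by rewrite faceE.
- by move=> l; rewrite !faceE.
Qed.

Lemma strip_init j s (y : Y j 0) : init (strip_edge s y) = chart (ends j s) _ (beta j _ y).
Proof. by rewrite /init strip_base base0. Qed.

Lemma strip_axis j s n i (y : Y j n) :
  face (axis i) (strip_cube s i y) = strip_edge s (base y).
Proof.
rewrite /strip_edge /strip_cube -cmap_face.
rewrite (@prism_face_prism _ _ _ _ _ _ _ (corner n) ord0 false) ?addbF //.
  by rewrite faceE eqxx.
by move=> l; rewrite !faceE eq_sym (negPf (neq_lift _ _)).
Qed.

Lemma strip_axis_lift j s n i (y : Y j n) l :
  face (axis (lift i l)) (strip_cube s i y) =
  chart (ends j s) _ (beta j _ (face (axis l) y)).
Proof.
rewrite /strip_cube -cmap_face (@prism_face_level _ _ _ _ _ _ _ (axis l) false).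
- by rewrite addbF strip_level.
- by rewrite faceE (negPf (neq_lift _ _)).
- by move=> l'; rewrite !faceE (inj_eq lift_inj).
Qed.

Lemma strip_rev j s (y : Y j 0) : rev_edge (strip_edge s y) = strip_edge (~~ s) y.
Proof.
rewrite /rev_edge /strip_edge /strip_cube -cmap_face.
rewrite (@prism_face_prism _ _ _ _ _ _ _ (face_id 0) ord0 true) ?addbT ?face_1 //.
  by rewrite faceE.
by case.
Qed.

Lemma I2_cases (i : 'I_2) : i = ord0 \/ i = ord_max.
Proof. by case: i => -[|[|i]] li //; [left|right]; apply: val_inj. Qed.

(** Characteristic maps order the coordinates, so strip squares come in two forms: the strip
    direction is first here and last in [strip_square1]. *)
Lemma strip_square0 j s (y : Y j 1) (c := strip_cube s ord0 y) :
  [/\ face (axis ord0) c = strip_edge s (init y),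
      face (axis ord_max) c = chart (ends j s) _ (beta j _ y),
      face far0 c = strip_edge s (term y)
    & face far1 c = chart (ends j (~~ s)) _ (beta j _ y)].
Proof.
have lE (l : 'I_1) : lift (ord0 : 'I_2) l = ord_max by apply: val_inj; rewrite (ord1 l).
split.
- exact: strip_axis.
- rewrite -[ord_max](lE ord0) strip_axis_lift; congr (chart _ _ (beta j _ _)).
  by rewrite -[RHS]face_1; congr face; apply: face_map_eq => l; rewrite !faceE !(ord1 l).
- rewrite /c /strip_edge /strip_cube -cmap_face term_tip.
  rewrite (@prism_face_prism _ _ _ _ _ _ _ tip ord0 false) ?addbF //.
    by rewrite faceE.
  by move=> l; rewrite tipE faceE lE.
- rewrite /c /strip_cube -cmap_face (@prism_face_level _ _ _ _ _ _ _ (face_id 1) true).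
  + by rewrite addbT strip_level face_1.
  + by rewrite faceE.
  + by move=> l; rewrite lE !faceE (ord1 l).
Qed.

Lemma strip_square1 j s (y : Y j 1) (c := strip_cube s ord_max y) :
  [/\ face (axis ord_max) c = strip_edge s (init y),
      face (axis ord0) c = chart (ends j s) _ (beta j _ y),
      face far1 c = strip_edge s (term y)
    & face far0 c = chart (ends j (~~ s)) _ (beta j _ y)].
Proof.
have lE (l : 'I_1) : lift (ord_max : 'I_2) l = ord0 by apply: val_inj; rewrite (ord1 l).
split.
- exact: strip_axis.
- rewrite -[ord0 : 'I_2](lE ord0) strip_axis_lift; congr (chart _ _ (beta j _ _)).
  by rewrite -[RHS]face_1; congr face; apply: face_map_eq => l; rewrite !faceE !(ord1 l).
- rewrite /c /strip_edge /strip_cube -cmap_face term_tip.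
  rewrite (@prism_face_prism _ _ _ _ _ _ _ tip ord0 false) ?addbF //.
    by rewrite faceE.
  by move=> l; rewrite tipE faceE lE.
- rewrite /c /strip_cube -cmap_face (@prism_face_level _ _ _ _ _ _ _ (face_id 1) true).
  + by rewrite addbT strip_level face_1.
  + by rewrite faceE.
  + by move=> l; rewrite lE !faceE (ord1 l).
Qed.

Lemma star_edge k b (e : X 1) : init e = chart k _ b ->
  (exists a, init a = b /\ chart k _ a = e) \/
  (exists j s (y : Y j 0), [/\ ends j s = k, beta j _ y = b & strip_edge s y = e]).
Proof.
move=> eb; have [[a ae]|[j [s [i [y [jk ye]]]]]] := chart_star eb; [left|right].
  by exists a; split=> //; apply: (@chart_inj _ _ C k); rewrite cmap_init ae.
rewrite (ord1 i) in ye.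
exists j, s, y; split=> //; apply: (@chart_inj _ _ C k).
by rewrite -eb -ye -[strip j _ _]/(strip_edge s y) strip_init jk.
Qed.

Lemma star_square k b (c : X 2) : base c = chart k _ b ->
  (exists a, base a = b /\ chart k _ a = c) \/
  (exists j s i (y : Y j 1),
     [/\ ends j s = k, beta j _ (init y) = b & strip_cube s i y = c]).
Proof.
move=> cb; have [[a ac]|[j [s [i [y [jk yc]]]]]] := chart_star cb; [left|right].
  by exists a; split=> //; apply: (@chart_inj _ _ C k); rewrite cmap_base ac.
exists j, s, i, y; split=> //; apply: (@chart_inj _ _ C k).
by rewrite -cb -yc -[strip j _ _]/(strip_cube s i y) strip_base jk.
Qed.

Lemma strip_edge_inj j s (y : Y j 0) j' s' (y' : Y j' 0) :
  strip_edge s y = strip_edge s' y' -> ends j s = ends j' s' ->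
  existT (fun j => (bool * Y j 0)%type) j (s, y) = existT _ j' (s', y').
Proof.
move=> e ee; have := strip_inj e ee.
by move/(congr1 (fun t => existT (fun j => (bool * Y j 0)%type) (projT1 t)
  ((projT2 t).1.1, (projT2 t).2))).
Qed.

Lemma chart_strip_edge k (a : B 1) j s (y : Y j 0) : chart k _ a <> strip_edge s y.
Proof. exact: chart_strip. Qed.

Lemma consecutive_chart k a a' :
  consecutive (chart k _ a) (chart k _ a') -> consecutive a a'.
Proof.
case=> c [ca ca']; have cb : base c = chart k _ (init a).
  by rewrite -(base_axis ord0) ca cmap_init.
have [[d [_ dc]]|[j [s [i [y [jk _ yc]]]]]] := star_square cb.
  exists d; split; apply: (@chart_inj _ _ C k); by rewrite cmap_face dc.
(* [i] is the position of the strip direction, so the side [axis i] would be both a chart edge and a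
   strip edge. *)
case: (@chart_strip_edge k (if i == ord0 then a else a') j s (init y)).
move: ca ca'; rewrite -yc; case: (I2_cases i) => ->.
  by have [-> _ _ _] := strip_square0 s y.
by have [-> _ _ _] := strip_square1 s y.
Qed.

Lemma consecutive_strip k a j s (y : Y j 0) : ends j s = k ->
  consecutive (chart k _ a) (strip_edge s y) ->
  exists e, init e = y /\ beta j _ e = a.
Proof.
move=> jk [c [ca cy]]; have cb : base c = chart k _ (init a).
  by rewrite -(base_axis ord0) ca cmap_init.
have [[d [_ dc]]|[j' [s' [i [y' [j'k _ yc]]]]]] := star_square cb.
  case: (@chart_strip_edge k (face (axis ord_max) d) j s y).
  by rewrite cmap_face dc.
move: ca cy; rewrite -yc; case: (I2_cases i) => ->.
  have [-> _ _ _] := strip_square0 s' y'.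
  by move=> /esym/chart_strip_edge.
have [-> -> _ _] := strip_square1 s' y' => ya yy.
have := strip_edge_inj yy; rewrite j'k jk => /(_ erefl) e.
have ej : j' = j := congr1 (@projT1 _ _) e.
subst j'; have [_ y'y] := inj_pair2 _ _ _ _ _ e.
exists y'; split=> //.
by apply: (@chart_inj _ _ C k); rewrite -ya j'k.
Qed.

Lemma consecutive_strips k j s (y : Y j 0) j' s' (y' : Y j' 0) :
  ends j s = k -> ends j' s' = k ->
  ~ consecutive (strip_edge s y) (strip_edge s' y').
Proof.
move=> jk j'k [c [cy cy']].
have cb : base c = chart k _ (beta j _ y) by rewrite -(base_axis ord0) cy strip_init jk.
have [[d [_ dc]]|[j1 [s1 [i [y1 [_ _ yc]]]]]] := star_square cb.
  by apply: (@chart_strip_edge k (face (axis ord0) d) j s y); rewrite cmap_face dc.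
move: cy cy'; rewrite -yc; case: (I2_cases i) => ->.
  by have [_ -> _ _] := strip_square0 s1 y1 => _ /chart_strip_edge.
by have [_ -> _ _] := strip_square1 s1 y1 => /chart_strip_edge.
Qed.

(** The link is that of [b] in B, together with a cone over the link of [y] for each strip end at
    [k] and each [y] above [b]; the cone point is the strip edge. A simplex contains at most one
    cone point, which decides whether it is compared in B or in a strip. *)
Lemma charts_link_simplicial k b : link_simplicial (chart k _ b).
Proof.
split=> [[|n] c cb|[|n] c c' cb c'b cc']; first by move=> [].
- have [[d dc]|[j [s [i0 [y [jk yc]]]]]] := chart_star cb => i i'; rewrite -?dc -?yc.
    rewrite -!cmap_face => /chart_inj.
    by have [[H _] _] := base_npc C (base d); apply: (H _ d).
  rewrite -[strip j _ _]/(strip_cube s i0 y).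
  case: (unliftP i0 i) => [l ->|->]; case: (unliftP i0 i') => [l' ->|->] //.
  + rewrite !strip_axis_lift => /chart_inj/local_isometry_inj H.
    congr lift; have [[H' _] _] := @strip_npc _ _ C j (base y).
    apply: (H' _ y) => //; apply: H; last by rewrite !base_axis.
    exact: strip_isometry.
  + by rewrite strip_axis strip_axis_lift => /chart_strip_edge.
  + by rewrite strip_axis strip_axis_lift => /esym/chart_strip_edge.
- by rewrite -(base0 c) cb -c'b base0.
- have [[d dc]|[j [s [i0 [y [jk yc]]]]]] := chart_star cb;
  have [[d' dc']|[j' [s' [i0' [y' [j'k yc']]]]]] := chart_star c'b.
  + rewrite -dc -dc'; congr (chart _ _ _).
    have bd : base d = b by apply: (@chart_inj _ _ C k); rewrite cmap_base dc.
    have bd' : base d' = b by apply: (@chart_inj _ _ C k); rewrite cmap_base dc'.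
    have [[_ H] _] := base_npc C b; apply: H => // i.
    by apply: (@chart_inj _ _ C k); rewrite !cmap_face dc dc'.
  + have := cc' i0'; rewrite -dc -yc' -[strip j' _ _]/(strip_cube s' i0' y').
    by rewrite strip_axis -cmap_face => /chart_strip_edge.
  + have := cc' i0; rewrite -dc' -yc -[strip j _ _]/(strip_cube s i0 y).
    by rewrite strip_axis -cmap_face => /esym/chart_strip_edge.
  + rewrite -[strip j _ _]/(strip_cube s i0 y) in yc.
    rewrite -[strip j' _ _]/(strip_cube s' i0' y') in yc'.
    (* Exactly one axis of a strip cube is a strip edge, so equal axes force equal positions of the
       strip direction. *)
    have ii' : i0 = i0'.
      have := cc' i0; rewrite -yc -yc' strip_axis.
      case: (unliftP i0' i0) => [l ->|->] //.
      by rewrite strip_axis_lift => /esym/chart_strip_edge.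
    subst i0'; have := cc' i0; rewrite -yc -yc' !strip_axis => /strip_edge_inj.
    rewrite jk j'k => /(_ erefl) e.
    have ej : j = j' := congr1 (@projT1 _ _) e.
    subst j'; have [es ey] := inj_pair2 _ _ _ _ _ e; subst s'.
    congr strip_cube; have [[_ H] _] := @strip_npc _ _ C j (base y).
    apply: H => [//|//|l]; apply: (local_isometry_inj (@strip_isometry _ _ C j)).
      by rewrite !base_axis.
    apply: (@chart_inj _ _ C (ends j s)).
    by rewrite -!(strip_axis_lift _ i0) yc yc' cc'.
Qed.

(** Cone points are pairwise non-adjacent, so a clique contains at most one. If it contains one, the
    other vertices lie in the link of [y], where fullness makes them a clique that flagness fills;
    the prism over that simplex fills the whole. Otherwise the clique lies in the link of [b] in
    B. *)
Lemma charts_link_flag k b : link_flag (chart k _ b).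
Proof.
move=> [|n] e eb ee; first by exists (chart k _ b); rewrite base0; split=> // -[].
case: (classic (exists i0 j s (y : Y j 0), [/\ ends j s = k, beta j _ y = b
  & strip_edge s y = e i0])) => [[i0 [j [s [y [jk yb ye]]]]]|N].
  have /fin_all_exists[a aP] : forall l : 'I_n, exists a, init a = y /\
      chart k _ (beta j _ a) = e (lift i0 l).
    move=> l; have [|_ Cl] := ee (lift i0 l) i0; first by rewrite eq_sym neq_lift.
    rewrite -ye in Cl; have [[d [db dl]]|[j' [s' [y' [j'k _ yl]]]]] := star_edge (eb (lift i0 l)).
      rewrite -dl in Cl; have [a [ay ad]] := consecutive_strip jk Cl.
      by exists a; rewrite ad.
    by rewrite -yl in Cl; case: (consecutive_strips j'k jk Cl).
  have [_ /(_ n a)[l|l l' ll'|c [cy ca]]] := @strip_npc _ _ C j y.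
  - by case: (aP l).
  - have [ay al] := aP l; have [a'y al'] := aP l'.
    have [|Nll Cll] := ee (lift i0 l) (lift i0 l'); first by rewrite (inj_eq lift_inj).
    split; first by move=> e0; apply: Nll; rewrite -al -al' e0.
    rewrite -al -al' in Cll; have [d [d0 d1]] := consecutive_chart Cll.
    have [|d' [_ d'0 d'1]] := local_isometry_square (@strip_isometry _ _ C j) _ d0 d1.
      by rewrite ay.
    by exists d'.
  - exists (strip_cube s i0 c); rewrite strip_base cy jk yb; split=> // i.
    case: (unliftP i0 i) => [l ->|->]; last by rewrite strip_axis cy.
    by rewrite strip_axis_lift ca jk; case: (aP l).
have /fin_all_exists[a aP] : forall i, exists a, init a = b /\ chart k _ a = e i.
  move=> i; have [[d [db di]]|[j [s [y [jk yb yi]]]]] := star_edge (eb i).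
    by exists d.
  by case: N; exists i, j, s, y.
have [_ /(_ n.+1 a)[i|i i' ii'|c [cb ca]]] := base_npc C b.
- by case: (aP i).
- have [ai ei] := aP i; have [ai' ei'] := aP i'; have [Nii Cii] := ee i i' ii'.
  split; first by move=> e0; apply: Nii; rewrite -ei -ei' e0.
  by rewrite -ei -ei' in Cii; apply: consecutive_chart Cii.
- exists (chart k _ c); rewrite -cmap_base cb; split=> // i.
  by rewrite -cmap_face ca; case: (aP i).
Qed.

Lemma charts_npc : (forall x, exists k b, chart k 0 b = x) -> nonpositively_curved X.
Proof.
move=> H x; have [k [b <-]] := H x.
by split; [apply: charts_link_simplicial | apply: charts_link_flag].
Qed.

End ChartSystem.

(** * Base change of the strips to Z *)

Section Pullback.

Variables (X B Z : cube_complex) (C : chart_system X B) (pi : cmap Z B).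

Local Notation J := (strip_index C).
Local Notation Y := (@strip_space _ _ C).
Local Notation beta := (@strip_map _ _ C).

Definition pullback_cube n : Type :=
  {t : {j : J & Y j n} * Z n | beta _ _ (projT2 t.1) = pi _ t.2}.

Lemma pullback_cube_eq n (t t' : pullback_cube n) : sval t = sval t' -> t = t'.
Proof.
by case: t t' => [t tP] [t' t'P] /= tt'; subst; rewrite (proof_irrelevance _ tP t'P).
Qed.

Lemma pullback_faceP m n (f : face_map m n) (t : {j : J & Y j n} * Z n) :
  beta _ _ (projT2 t.1) = pi _ t.2 ->
  beta _ _ (face f (projT2 t.1)) = pi _ (face f t.2).
Proof. by move=> tP; rewrite !cmap_face tP. Qed.

Definition pullback_face m n (f : face_map m n) (t : pullback_cube n) :
    pullback_cube m :=
  exist _ (existT _ (projT1 (sval t).1) (face f (projT2 (sval t).1)), face f (sval t).2)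
    (pullback_faceP f (svalP t)).

Lemma pullback_face_1 n (t : pullback_cube n) : pullback_face (face_id n) t = t.
Proof.
by apply: pullback_cube_eq; case: t => [[[j y] z] tP] /=; rewrite !face_1.
Qed.

Lemma pullback_face_c m n p (f : face_map m n) (g : face_map p m) (t : pullback_cube n) :
  pullback_face (face_comp f g) t = pullback_face g (pullback_face f t).
Proof. by apply: pullback_cube_eq => /=; rewrite !face_c. Qed.

Lemma pullback_face_free n (f : face_map n n) (t : pullback_cube n) :
  pullback_face f t = t -> f = face_id n.
Proof. by move=> /(congr1 (fun t => (sval t).2))/face_free. Qed.

(* The disjoint union of the fibre products of the strips with Z over B *)
Definition pullback : cube_complex :=
  CubeComplex pullback_face_1 pullback_face_c pullback_face_free.

Definition pullback_map : cmap pullback Z :=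
  @CMap pullback Z (fun n t => (sval t).2) (fun m n f t => erefl).

Definition pb_index n (t : pullback n) : J := projT1 (sval t).1.
Definition pb_strip n (t : pullback n) : Y (pb_index t) n := projT2 (sval t).1.

Lemma pb_eq n (t : pullback n) : beta _ _ (pb_strip t) = pi _ (pullback_map _ t).
Proof. exact: svalP t. Qed.

Definition pb_cube j n (y : Y j n) (z : Z n) (yz : beta j _ y = pi _ z) : pullback n :=
  exist _ (existT _ j y, z) yz.

(** Local isometries are stable under base change: the Z component of a lift is prescribed, and its
    strip component is supplied by the local isometry [strip_map j] applied to the image in B. *)
Lemma pullback_isometry : local_isometry pullback_map.
Proof.
move=> v; split.
  move=> [[[j y] z] tP] [[[j' y'] z'] t'P] ev e'v zz'.
  have := congr1 (fun t => (sval t).1) (etrans e'v (esym ev)) => /= {ev e'v}e.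
  have {}zz' : z = z' := zz'; subst z'.
  have jj' : j' = j := congr1 (@projT1 _ _) e; subst j'.
  apply: pullback_cube_eq => /=; congr (existT _ _ _, _).
  apply: (local_isometry_inj (@strip_isometry _ _ C j)); last exact: etrans tP (esym t'P).
  exact: esym (inj_pair2 _ _ _ _ _ e).
case: v => [[[j y] z] /= vP] n c cz cE.
have [_ /(_ n (pi _ c))[||y' [y'y y'c]]] := @strip_isometry _ _ C j y.
- by rewrite -cmap_base cz.
- move=> i; have [[[[j' e] a] eP] [ev ea]] := cE i.
  have {}ea : a = face (axis i) c := ea; subst a.
  have {}ev := congr1 (fun t => (sval t).1) ev; rewrite /= in ev; rewrite /= in eP.
  have jj' : j' = j := congr1 (@projT1 _ _) ev; subst j'.
  by exists e; rewrite eP cmap_face; split=> //; apply: inj_pair2 _ _ _ _ _ ev.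
exists (pb_cube y'c); split=> //; apply: pullback_cube_eq => /=.
by rewrite -[face _ y']/(base y') y'y -[face _ c]/(base c) cz.
Qed.

End Pullback.

(** * The regular cover and its hyperplanes *)

Section SpecialCover.

Variables (X B Z : cube_complex) (C : chart_system X B) (pi : cmap Z B).

Local Notation K := (chart_index C).
Local Notation J := (strip_index C).
Local Notation Y := (@strip_space _ _ C).
Local Notation beta := (@strip_map _ _ C).
Local Notation ends := (@strip_end _ _ C).
Local Notation P := (pullback C pi).
Local Notation pmap := (pullback_map C pi).

Hypotheses (pi_cov : covering pi) (Zs : edge_special Z) (X_conn : connected X).

Variables (F : Type) (p : Z 1 -> F -> F) (N : Z 1 -> F -> Prop) (i : P 0 -> F).

Hypothesis i_inj : injective i.
Hypothesis p_par : forall a b x, parallel a b -> p a x = p b x.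
Hypothesis p_rev : forall a x, p (rev_edge a) (p a x) = x.
Hypothesis p_comm : forall a b x, consecutive a b -> p a (p b x) = p b (p a x).
Hypothesis N_par : forall a b x, parallel a b -> N a x -> N b x.
Hypothesis N_cross : forall a b x, consecutive a b -> N a x <-> N a (p b x).
Hypothesis N_rev : forall a x, N a x -> N (rev_edge a) (p a x).
Hypothesis p_step : forall e : P 1,
  p (pmap _ e) (i (init e)) = i (term e) /\ N (pmap _ e) (i (init e)).
Hypothesis N_lift : forall a t, N a (i t) -> init a = pmap _ t ->
  exists e, init e = t /\ pmap _ e = a.

(* A vertex of the cover is a chart, a vertex of Z and an element of the regular
   cover of Z on which the edges [a] of Z act by [p a]. *)
Definition cstate : Type := (K * Z 0 * (F -> F))%type.

Implicit Types (s : cstate) (e : X 1) (a : Z 1).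

Definition cpos s : X 0 := chart s.1.1 _ (pi _ s.1.2).

(** Composition on the left: evaluating at a fixed [f] turns a walk in the cover into an orbit of
    the permutations [p a] on F. *)
Definition act a (g : F -> F) : F -> F := fun x => p a (g x).

(** [a] is the lift to Z of an edge lying in the chart of [s]. *)
Definition vert_edge e s a : Prop :=
  init a = s.1.2 /\ chart s.1.1 _ (pi _ a) = e.

(** The edge runs along a strip, from its end [d] to its end [~~ d], over the vertex [t] of the
    pullback. *)
Definition hor_edge e s (d : bool) (t : P 0) : Prop :=
  [/\ ends (pb_index t) d = s.1.1, pmap _ t = s.1.2 & strip_edge d (pb_strip t) = e].

(** Strip edges change only the chart, because the map to B collapses the interval direction and all
    other monodromy is pulled back along it. *)
Definition cmove e s s' : Prop :=
  (exists a, vert_edge e s a /\ s' = (s.1.1, term a, act a s.2)) \/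
  (exists d t, hor_edge e s d t /\ s' = (ends (pb_index t) (~~ d), s.1.2, s.2)).

Lemma vert_edge_fun e s a a' : vert_edge e s a -> vert_edge e s a' -> a = a'.
Proof.
move=> [az ae] [a'z a'e]; apply: (covering_inj pi_cov).
  by rewrite -!/(init _) az a'z.
by apply: (@chart_inj _ _ C s.1.1); rewrite ae a'e.
Qed.

Lemma vert_hor e s a d t : vert_edge e s a -> hor_edge e s d t -> False.
Proof. by move=> [_ <-] [_ _ /esym/chart_strip_edge]. Qed.

Lemma hor_edge_fun e s d t d' t' : hor_edge e s d t -> hor_edge e s d' t' ->
  d = d' /\ t = t'.
Proof.
case: t t' => [[[j y] z] tP] [[[j' y'] z'] t'P]; rewrite /hor_edge /= => -[jk zs <-] [j'k z's ye].
have E := strip_edge_inj ye (etrans j'k (esym jk)).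
have jj' : j' = j := congr1 (@projT1 _ _) E; subst j'.
have [dd' yy'] := inj_pair2 _ _ _ _ _ E; have {}yy' : y' = y := yy'; subst d' y'.
split=> //; apply: pullback_cube_eq => /=; congr pair.
exact: etrans zs (esym z's).
Qed.

Lemma edge_cases e s : cpos s = init e ->
  (exists a, vert_edge e s a) \/ (exists d t, hor_edge e s d t).
Proof.
move=> /esym/star_edge[[b [bz be]]|[j [d [y [jk yz ye]]]]]; [left|right].
  have [a [az ab]] := covering_lift pi_cov bz.
  by exists a; split=> //; rewrite ab.
by exists d, (pb_cube yz).
Qed.

Lemma cmove_init e s s' : cmove e s s' -> cpos s = init e.
Proof.
case=> [[a [[az <-] _]]|[d [t [[jk tz <-] _]]]].
  by rewrite -!cmap_init az.
by rewrite strip_init jk pb_eq tz.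
Qed.

Lemma cmove_vert e s s' a : cmove e s s' -> vert_edge e s a ->
  s' = (s.1.1, term a, act a s.2).
Proof.
case=> [[a' [a'e ->]]|[d [t [te _]]]] ae; last by case: (vert_hor ae te).
by rewrite (vert_edge_fun ae a'e).
Qed.

Lemma cmove_hor e s s' d t : cmove e s s' -> hor_edge e s d t ->
  s' = (ends (pb_index t) (~~ d), s.1.2, s.2).
Proof.
case=> [[a [ae _]]|[d' [t' [t'e ->]]]] te; first by case: (vert_hor ae te).
by have [-> ->] := hor_edge_fun te t'e.
Qed.

Lemma vert_edge_rev e s s' a : cmove e s s' -> vert_edge e s a ->
  vert_edge (rev_edge e) s' (rev_edge a) /\ s = (s'.1.1, term (rev_edge a), act (rev_edge a) s'.2).
Proof.
move=> M ae; rewrite (cmove_vert M ae) {M}; case: ae => az ae.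
rewrite /vert_edge /= !cmap_rev ae; split=> //.
rewrite term_rev az; case: s az {ae} => [[k z] g] /= _; congr pair.
by apply: functional_extensionality => x; rewrite /act p_rev.
Qed.

Lemma hor_edge_rev e s s' d t : cmove e s s' -> hor_edge e s d t ->
  hor_edge (rev_edge e) s' (~~ d) t /\ s = (ends (pb_index t) (~~ ~~ d), s'.1.2, s'.2).
Proof.
move=> M te; rewrite (cmove_hor M te) {M}; case: te => jk tz te.
split; first by split=> //=; rewrite -strip_rev te.
by rewrite negbK jk; case: s {jk tz te} => [[]].
Qed.

Lemma cmove_rev e s s' : cmove e s s' -> cmove (rev_edge e) s' s.
Proof.
move=> M; case: (M) => [[a [ae _]]|[d [t [te _]]]]; [left|right].
  by exists (rev_edge a); apply: vert_edge_rev.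
by exists (~~ d), t; apply: hor_edge_rev.
Qed.

Lemma cmove_fun e s s1 s2 : cmove e s s1 -> cmove e s s2 -> s1 = s2.
Proof.
move=> M; case=> [[a [ae ->]]|[d [t [te ->]]]].
  exact: cmove_vert ae.
exact: cmove_hor te.
Qed.

Lemma cmove_ex e s : cpos s = init e -> exists s', cmove e s s'.
Proof.
move=> /edge_cases[[a ae]|[d [t te]]].
  by exists (s.1.1, term a, act a s.2); left; exists a.
by exists (ends (pb_index t) (~~ d), s.1.2, s.2); right; exists d, t.
Qed.

Lemma square_cases (c : X 2) s : cpos s = base c ->
  [\/ exists c' : Z 2, base c' = s.1.2 /\ chart s.1.1 _ (pi _ c') = c,
      exists d (u : P 1), [/\ ends (pb_index u) d = s.1.1, pmap _ (init u) = s.1.2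
                            & strip_cube d ord0 (pb_strip u) = c]
    | exists d (u : P 1), [/\ ends (pb_index u) d = s.1.1, pmap _ (init u) = s.1.2
                            & strip_cube d ord_max (pb_strip u) = c]].
Proof.
move=> /esym/star_square[[b [bz bc]]|[j [d [l [y [jk yz yc]]]]]].
  have [c' [c'z c'b]] := covering_lift pi_cov bz.
  by constructor 1; exists c'; rewrite c'b.
have [|a [az ay]] := @covering_lift _ _ _ pi_cov s.1.2 1 (beta j _ y).
  by rewrite -cmap_base.
have ya : beta j _ y = pi _ a by [].
case: (I2_cases l) yc => -> yc; [constructor 2|constructor 3];
  by exists d, (pb_cube ya); split.
Qed.

(** In a chart, opposite sides act alike by [p_par] and adjacent ones commute by [p_comm]. In a
    strip, the two sides across the strip direction have the same lift to Z, so the group component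
    closes up at once. *)
Lemma cmove_square (c : X 2) s : cpos s = base c ->
  exists s0 s1 s01,
    [/\ cmove (face (axis ord0) c) s s0, cmove (face (axis ord_max) c) s s1,
        cmove (face far0 c) s1 s01 & cmove (face far1 c) s0 s01].
Proof.
case: s => [[k z] g] /square_cases[|[d [u]]|[d [u]]] /=.
- move=> [c' [cz <-]]; set a := face (axis ord0) c'; set b := face (axis ord_max) c'.
  exists (k, term a, act a g), (k, term b, act b g),
    (k, term (face far0 c'), act (face far0 c') (act b g)).
  rewrite -!cmap_face; split; left.
  + by exists a; rewrite /vert_edge /a base_axis.
  + by exists b; rewrite /vert_edge /b base_axis.
  + by exists (face far0 c'); rewrite /vert_edge init_far0.
  + exists (face far1 c'); rewrite /vert_edge init_far1; split=> //=.
    rewrite term_far; congr (_, _, _); apply: functional_extensionality => x.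
    rewrite /act (p_par _ (parallel_far0 c')) (p_par _ (parallel_far1 c')).
    by apply: p_comm; apply: consecutive_axis.
- move=> [jk uz <-]; have [-> -> -> ->] := strip_square0 d (pb_strip u).
  set a := pmap _ u.
  exists (ends (pb_index u) (~~ d), z, g), (k, term a, act a g),
    (ends (pb_index u) (~~ d), term a, act a g).
  split.
  + by right; exists d, (init u).
  + by left; exists a; rewrite /vert_edge pb_eq jk.
  + by right; exists d, (term u).
  + by left; exists a; rewrite /vert_edge pb_eq.
- move=> [jk uz <-]; have [-> -> -> ->] := strip_square1 d (pb_strip u).
  set a := pmap _ u.
  exists (k, term a, act a g), (ends (pb_index u) (~~ d), z, g),
    (ends (pb_index u) (~~ d), term a, act a g).
  split.
  + by left; exists a; rewrite /vert_edge pb_eq jk.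
  + by right; exists d, (init u).
  + by left; exists a; rewrite /vert_edge pb_eq.
  + by right; exists d, (term u).
Qed.

Variables (k0 : K) (z0 : Z 0).

(** This selects a connected component and also ensures that the group components are products of
    the [p a], hence surjective ([reachable_surj]). *)
Definition reachable s : Prop :=
  clos_refl_trans_n1 _ (fun s s' => exists e, cmove e s s') (k0, z0, id) s.

Lemma reachable_move e s s' : reachable s -> cmove e s s' -> reachable s'.
Proof. by move=> rs M; apply: Relation_Operators.rtn1_trans rs; exists e. Qed.

Lemma reachable_surj s : reachable s -> forall x, exists f, s.2 f = x.
Proof.
elim=> [x|s1 s2 [e M] _ IH x]; first by exists x.
have := M; case=> [[a [_ ->]]|[d [t [_ ->]]]] //=; rewrite /act.
have [f fx] := IH (p (rev_edge a) x); exists f.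
by rewrite fx -{1}[a]rev_edgeK p_rev.
Qed.

Definition rstate : Type := {s | reachable s}.
Definition rpos (s : rstate) : X 0 := cpos (sval s).
Definition rmove e (s s' : rstate) : Prop := cmove e (sval s) (sval s').

Lemma rstate_eq (s s' : rstate) : sval s = sval s' -> s = s'.
Proof.
by case: s s' => [s sP] [s' s'P] /= ss'; subst; rewrite (proof_irrelevance _ sP s'P).
Qed.

Lemma rmove_init e (s s' : rstate) : rmove e s s' -> rpos s = init e.
Proof. exact: cmove_init. Qed.

Lemma rmove_rev e (s s' : rstate) : rmove e s s' -> rmove (rev_edge e) s' s.
Proof. exact: cmove_rev. Qed.

Lemma rmove_fun e (s s1 s2 : rstate) : rmove e s s1 -> rmove e s s2 -> s1 = s2.
Proof. by move=> M1 M2; apply: rstate_eq; apply: cmove_fun M2. Qed.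

Lemma rmove_ex e (s : rstate) : rpos s = init e -> exists s' : rstate, rmove e s s'.
Proof.
move=> /cmove_ex[s' M]; exists (exist _ s' (reachable_move (svalP s) M)).
exact: M.
Qed.

Lemma rmove_square (c : X 2) (s : rstate) : rpos s = base c ->
  exists s0 s1 s01 : rstate,
    [/\ rmove (face (axis ord0) c) s s0, rmove (face (axis ord_max) c) s s1,
        rmove (face far0 c) s1 s01 & rmove (face far1 c) s0 s01].
Proof.
move=> /cmove_square[s0 [s1 [s01 [M0 M1 M01 M10]]]].
have r0 := reachable_move (svalP s) M0; have r1 := reachable_move (svalP s) M1.
by exists (exist _ s0 r0), (exist _ s1 r1), (exist _ s01 (reachable_move r1 M01)).
Qed.

(** Paths of the connected complex X lift. In particular the charts reached from [k0] cover all
    vertices of X, which is not among the axioms of a chart system. *)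
Lemma rpos_surj x : exists s : rstate, rpos s = x.
Proof.
pose s0 : rstate := exist _ _ (Relation_Operators.rtn1_refl _ _ _).
have [_ /(_ (rpos s0) x) H] := X_conn.
suff: (exists s : rstate, rpos s = rpos s0) <-> (exists s : rstate, rpos s = x).
  by case=> H1 _; apply: H1; exists s0.
elim: H => [u v [e [<- <-]]|//|u v _ [? ?]|u v w _ [H1 H2] _ [H3 H4]]; try by split; auto.
split=> -[s se].
  have [s' /rmove_rev/rmove_init H] := rmove_ex se; by exists s'.
have [s' /rmove_rev/rmove_init H] := rmove_ex (se : rpos s = init (rev_edge e)).
by exists s'; rewrite H init_rev term_rev.
Qed.

Definition scover : cube_complex := monodromy_cover rpos rmove.
Definition scover_proj : cmap scover X := cover_proj rpos rmove.

Lemma scover_covering : covering scover_proj.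
Proof.
exact: (cover_covering rmove_init rmove_rev rmove_fun rmove_ex rmove_square rpos_surj).
Qed.

Lemma scover_npc : nonpositively_curved scover.
Proof.
apply: (covering_npc scover_covering); apply: (@charts_npc _ _ C) => x.
by have [s <-] := rpos_surj x; exists (sval s).1.1, (pi _ (sval s).1.2).
Qed.

Definition st n (E : scover n) : cstate := sval (state E).
Local Notation pr := (scover_proj _).

Lemma st_move (E : scover 1) : cmove (pr E) (st E) (st (rev_edge E)).
Proof. exact: (T_state E). Qed.

Lemma st_base n (E : scover n) : st (base E) = st E.
Proof. by rewrite /st state_base. Qed.

Lemma st_pos n (E : scover n) : cpos (st E) = base (pr E).
Proof. exact: (q_state E). Qed.

Lemma scover_eq n (E E' : scover n) : pr E = pr E' -> st E = st E' -> E = E'.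
Proof.
move=> EE' ss'; apply: (cover_eq rmove_init rmove_fun rmove_ex) => //.
exact: rstate_eq.
Qed.

Lemma scover_lift (E : scover 0) n (c : X n) : cpos (st E) = base c ->
  exists D : scover n, st D = st E /\ pr D = c.
Proof.
move=> Ec.
have [D [DE Dc]] := cover_lift rmove_init rmove_rev rmove_fun rmove_ex rmove_square Ec.
by exists D; rewrite /st DE.
Qed.

Lemma scover_vert (E E' : scover 0) : st E = st E' -> E = E'.
Proof.
by move=> EE'; apply: scover_eq => //; rewrite -[LHS]base0 -[RHS]base0 -!st_pos EE'.
Qed.

Lemma scover_connected : connected scover.
Proof.
have [V0 [V0s _]] := cover_lift rmove_init rmove_rev rmove_fun rmove_ex rmove_square
  (esym (base0 (rpos (exist _ _ (Relation_Operators.rtn1_refl _ _ _))))).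
split; first by exists.
suff H s : reachable s -> forall V : scover 0, st V = s ->
    clos_refl_sym_trans (scover 0)
      (fun u v => exists e : scover 1, init e = u /\ term e = v) V0 V.
  move=> u v; apply: rst_trans (H _ (svalP (state v)) v erefl).
  by apply: rst_sym; apply: H (svalP (state u)) u erefl.
move=> rs; have V0s' : st V0 = (k0, z0, id) by rewrite /st V0s.
elim: rs => [V Vs|s1 s2 [e M] r1 IH V Vs].
  by rewrite (@scover_vert V V0) ?V0s' //; apply: rst_refl.
have M' : rmove e (exist _ s1 r1) (exist _ s2 (reachable_move r1 M)) by [].
have [E [Ee E1 E2]] := cover_edge rmove_init rmove_rev rmove_fun rmove_ex rmove_square M'.
apply: (rst_trans _ _ _ (init E)).
  by apply: IH; rewrite st_base /st E1.
apply: rst_step; exists E; split=> //; apply: scover_vert.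
by rewrite /term /init st_base Vs /st E2.
Qed.

Definition vertical (E : scover 1) a : Prop := vert_edge (pr E) (st E) a.
Definition horizontal (E : scover 1) d t : Prop := hor_edge (pr E) (st E) d t.

Lemma scover_cases (E : scover 1) :
  (exists a, vertical E a) \/ (exists d t, horizontal E d t).
Proof. by apply: edge_cases; rewrite st_pos. Qed.

Lemma vertical_rev (E : scover 1) a : vertical E a ->
  vertical (rev_edge E) (rev_edge a) /\
  (st E).2 = act (rev_edge a) (st (rev_edge E)).2.
Proof.
move=> Ea; have [H1 H2] := vert_edge_rev (st_move E) Ea; split=> //.
by rewrite [in LHS]H2.
Qed.

Lemma horizontal_rev (E : scover 1) d t : horizontal E d t ->
  horizontal (rev_edge E) (~~ d) t /\ (st E).2 = (st (rev_edge E)).2.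
Proof.
move=> Et; have [H1 H2] := hor_edge_rev (st_move E) Et; split=> //.
by rewrite [in LHS]H2.
Qed.

(* The part of the local structure at an edge that is invariant under
   parallelism. *)
Definition aligned (E E' : scover 1) : Prop :=
  (exists a a', [/\ vertical E a, vertical E' a', parallel a a'
     & forall f, N a ((st E).2 f) <-> N a' ((st E').2 f)]) \/
  (exists d t t', [/\ horizontal E d t, horizontal E' d t'
     & forall f, (st E).2 f = i t <-> (st E').2 f = i t']).

Lemma aligned_refl E : aligned E E.
Proof.
case: (scover_cases E) => [[a Ea]|[d [t Et]]]; [left|right].
  by exists a, a; split=> //; apply: rst_refl.
by exists d, t, t.
Qed.

Lemma aligned_sym E E' : aligned E E' -> aligned E' E.
Proof.
case=> [[a [a' [Ea E'a aa' H]]]|[d [t [t' [Et E't H]]]]]; [left|right].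
  by exists a', a; split=> // [|f]; [apply: rst_sym|rewrite H].
by exists d, t', t; split=> // f; rewrite H.
Qed.

Lemma aligned_trans E1 E2 E3 : aligned E1 E2 -> aligned E2 E3 -> aligned E1 E3.
Proof.
case=> [[a1 [a2 [Ea1 Ea2 a12 H]]]|[d [t1 [t2 [Et1 Et2 H]]]]];
case=> [[a2' [a3 [Ea2' Ea3 a23 H']]]|[d' [t2' [t3 [Et2' Et3 H']]]]].
- have e := vert_edge_fun Ea2 Ea2'; subst a2'; left; exists a1, a3.
  by split=> // [|f]; [apply: rst_trans a12 a23 | rewrite H].
- by case: (vert_hor Ea2 Et2').
- by case: (vert_hor Ea2' Et2).
- have [e e'] := hor_edge_fun Et2 Et2'; subst d' t2'; right; exists d, t1, t3.
  by split=> // f; rewrite H.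
Qed.

Lemma st_axis n (l : 'I_n) (D : scover n) : st (face (axis l) D) = st D.
Proof. by rewrite -st_base -/(init _) base_axis st_base. Qed.

Lemma st_far0 (D : scover 2) : cmove (face (axis ord_max) (pr D)) (st D) (st (face far0 D)).
Proof.
have := st_move (face (axis ord_max) D); rewrite st_axis cmap_face.
by rewrite -(st_base (rev_edge _)) -/(init _) -/(term _) -init_far0 st_base.
Qed.

(** Three kinds of squares: in a chart, the other side permutes F without affecting [N] by
    [N_cross]; along a strip edge, [p_step] carries [i (init u)] to [i (term u)]; for a vertical
    edge pushed through a strip, the group component is unchanged. *)
Lemma aligned_square (D : scover 2) : aligned (face (axis ord0) D) (face far0 D).
Proof.
have M := st_far0 D; case: (square_cases (st_pos D)) => [[c [cz cD]]|[d [u [jk uz cD]]]|[d [u [jk uz cD]]]].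
- have V : vert_edge (face (axis ord_max) (pr D)) (st D) (face (axis ord_max) c).
    by split; [rewrite base_axis | rewrite !cmap_face cD].
  have E := cmove_vert M V.
  left; exists (face (axis ord0) c), (face far0 c); split.
  + by split; rewrite ?st_axis ?base_axis // !cmap_face cD.
  + rewrite /vertical E; split; first exact: init_far0.
    by rewrite !cmap_face -cD.
  + by apply: rst_sym; apply: parallel_far0.
  + move=> f; rewrite E st_axis /= /act (N_cross _ (consecutive_axis c)).
    by split; apply: N_par; [apply: rst_sym|]; apply: parallel_far0.
- have [e0 e1 e2 e3] := strip_square0 d (pb_strip u).
  have V : vert_edge (face (axis ord_max) (pr D)) (st D) (pmap _ u).
    by split=> //; rewrite -cD e1 jk pb_eq.
  have E := cmove_vert M V.
  right; exists d, (init u), (term u); split.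
  + by split; rewrite ?st_axis // cmap_face -cD e0.
  + by rewrite /horizontal E; split=> //; rewrite cmap_face -cD e2.
  + move=> f; rewrite E st_axis /= /act; have [<- _] := p_step u.
    by split=> [->//|H]; rewrite -[LHS](p_rev (pmap _ u)) H p_rev.
- have [e0 e1 e2 e3] := strip_square1 d (pb_strip u).
  have V : hor_edge (face (axis ord_max) (pr D)) (st D) d (init u).
    by split=> //; rewrite -cD e0.
  have E := cmove_hor M V.
  left; exists (pmap _ u), (pmap _ u); split.
  + by split; rewrite ?st_axis // cmap_face -cD e1 jk pb_eq.
  + by rewrite /vertical E; split=> //; rewrite cmap_face -cD e3 pb_eq.
  + exact: rst_refl.
  + by move=> f; rewrite E st_axis.
Qed.

Lemma parallel_aligned E E' : parallel E E' -> aligned E E'.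
Proof.
elim=> [{}E {}E' [D [-> ->]]|{}E|{}E {}E' _|E1 E2 E3 _ H1 _ H2].
- have -> : side false = axis ord0 by apply: face_map_eq => j; rewrite !faceE.
  have -> : side true = far0 by apply: face_map_eq => j; rewrite !faceE.
  exact: aligned_square.
- exact: aligned_refl.
- exact: aligned_sym.
- exact: aligned_trans H1 H2.
Qed.

Lemma upar_vertical E E' a : upar E E' -> vertical E a ->
  exists a', [/\ vertical E' a', upar a a' & forall f, N a ((st E).2 f) -> N a' ((st E').2 f)].
Proof.
have H E'' : parallel E E'' -> vertical E a -> exists a', [/\ vertical E'' a', parallel a a'
    & forall f, N a ((st E).2 f) -> N a' ((st E'').2 f)].
  move=> /parallel_aligned[[a1 [a' [Ea1 Ea' aa' H]]]|[d [t [t' [Et _ _]]]]] Ea; last first.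
    by case: (vert_hor Ea Et).
  have e := vert_edge_fun Ea Ea1; subst a1; exists a'; split=> // f; by rewrite H.
case=> /H{}H /H[a' [E'a aa' Haa']]; first by exists a'; split=> //; left.
have [E'r E'g] := vertical_rev E'a; rewrite rev_edgeK in E'r E'g.
exists (rev_edge a'); split=> //; first by right; rewrite rev_edgeK.
move=> f /Haa'/N_rev; rewrite E'g /act.
by have := p_rev (rev_edge a') ((st E').2 f); rewrite rev_edgeK => ->.
Qed.

Lemma upar_horizontal E E' d t : upar E E' -> horizontal E d t ->
  exists d' t', horizontal E' d' t' /\ forall f, (st E).2 f = i t -> (st E').2 f = i t'.
Proof.
have H E'' : parallel E E'' -> horizontal E d t -> exists d' t', horizontal E'' d' t' /\
    forall f, (st E).2 f = i t -> (st E'').2 f = i t'.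
  move=> /parallel_aligned[[a [_ [Ea _ _ _]]]|[d1 [t1 [t' [Et1 E't H]]]]] Et.
    by case: (vert_hor Ea Et).
  have [e e'] := hor_edge_fun Et Et1; subst d1 t1; exists d, t'; split=> // f; by rewrite H.
case=> /H{}H /H[d' [t' [E't Htt']]]; first by exists d', t'.
have [E'r E'g] := horizontal_rev E't; rewrite rev_edgeK in E'r E'g.
by exists (~~ d'), t'; rewrite -E'g.
Qed.

Lemma st_surj (E : scover 1) x : exists f, (st E).2 f = x.
Proof. exact: reachable_surj (svalP (state E)) x. Qed.

Lemma consecutive_st (E E' : scover 1) : consecutive E E' -> st E = st E'.
Proof. by move=> [D [<- <-]]; rewrite !st_axis. Qed.

Lemma consecutive_cases (E E' : scover 1) : consecutive E E' ->
  [\/ exists a a', [/\ vertical E a, vertical E' a' & consecutive a a'],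
      exists d t a, [/\ horizontal E d t, vertical E' a & N a (i t)]
    | exists d t a, [/\ vertical E a, horizontal E' d t & N a (i t)]].
Proof.
move=> [D [<- <-]]; case: (square_cases (st_pos D)) => [[c [cz cD]]|[d [u [jk uz cD]]]|[d [u [jk uz cD]]]].
- constructor 1; exists (face (axis ord0) c), (face (axis ord_max) c).
  by split; [split..|exact: consecutive_axis]; rewrite ?st_axis ?base_axis // !cmap_face cD.
- have [e0 e1 e2 e3] := strip_square0 d (pb_strip u).
  constructor 2; exists d, (init u), (pmap _ u); split; last by case: (p_step u).
    by split; rewrite ?st_axis // cmap_face -cD e0.
  by split; rewrite ?st_axis // cmap_face -cD e1 jk pb_eq.
- have [e0 e1 e2 e3] := strip_square1 d (pb_strip u).
  constructor 3; exists d, (init u), (pmap _ u); split; last by case: (p_step u).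
    by split; rewrite ?st_axis // cmap_face -cD e1 jk pb_eq.
  by split; rewrite ?st_axis // cmap_face -cD e0.
Qed.

Lemma vertical_consecutive (E E' : scover 1) a a' : st E = st E' ->
  vertical E a -> vertical E' a' -> consecutive a a' -> consecutive E E'.
Proof.
move=> EE' [az aE] [a'z a'E] [c [ca ca']].
have [|D [Ds Dc]] := @scover_lift (base E) 2 (chart (st E).1.1 _ (pi _ c)).
  by rewrite st_base -!cmap_base -(base_axis ord0) ca az.
rewrite st_base in Ds; exists D; split; apply: scover_eq; rewrite ?st_axis ?Ds //.
  by rewrite cmap_face Dc -!cmap_face ca.
by rewrite cmap_face Dc -!cmap_face ca' EE'.
Qed.

(** [N_lift] converts the property of the permutation back into an edge of the pullback at [t], and
    the strip square over it is the one sought. With [consecutive_cases], adjacency of a strip edge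
    and a vertical edge thus amounts to [N a (i t)]. *)
Lemma horizontal_consecutive (E E' : scover 1) d t a : st E = st E' ->
  horizontal E d t -> vertical E' a -> N a (i t) -> consecutive E E'.
Proof.
move=> EE' [jk tz tE] [az aE] /N_lift[|u [ut ua]]; first by rewrite az tz EE'.
subst t; have [e0 e1 e2 e3] := strip_square0 d (pb_strip u).
have [|D [Ds Dc]] := @scover_lift (base E) 2 (strip_cube d ord0 (pb_strip u)).
  rewrite st_base strip_base /cpos -tz -jk.
  exact: congr1 (esym (pb_eq (init u))).
rewrite st_base in Ds; exists D; split; apply: scover_eq; rewrite ?st_axis ?Ds //.
  by rewrite cmap_face Dc e0.
rewrite cmap_face Dc e1 -aE -EE' -jk -ua pb_eq //.
Qed.

Lemma scover_edge_special : edge_special scover.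
Proof.
split.
- move=> E E' EE' uEE'; case: (consecutive_cases EE').
  + move=> [a [a' [Ea E'a aa']]]; have [a1 [E'a1 aa1 _]] := upar_vertical uEE' Ea.
    by rewrite -(vert_edge_fun E'a E'a1) in aa1; apply: (es_cross Zs) aa' aa1.
  + move=> [d [t [a [Et E'a _]]]]; have [d' [t' [E't _]]] := upar_horizontal uEE' Et.
    exact: vert_hor E'a E't.
  + move=> [d [t [a [Ea E't _]]]]; have [a' [E'a _ _]] := upar_vertical uEE' Ea.
    exact: vert_hor E'a E't.
- move=> E /parallel_aligned[[a [a' [Ea Ea' aa' _]]]|[d [t [t' [Et Et' _]]]]].
  + have [/vert_edge_fun/(_ Ea') e _] := vertical_rev Ea; subst a'.
    exact: (es_sided Zs) aa'.
  (* Aligned strip edges start at the same end [d], whereas reversal exchanges the ends. *)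
  + have [/hor_edge_fun/(_ Et')[e _] _] := horizontal_rev Et.
    by case: d e {Et Et'}.
- move=> E E' + /(congr1 (@st _)); rewrite !st_base => + EE'.
  move=> /parallel_aligned[[a [a' [Ea Ea' aa' _]]]|[d [t [t' [Et Et' H]]]]].
  + have e : a = a'.
      by apply: (es_direct Zs) => //; case: Ea => -> _; case: Ea' => -> _; rewrite EE'.
    by subst a'; apply: scover_eq => //; case: Ea => _ <-; case: Ea' => _ <-; rewrite EE'.
  (* The base point [f] with value [i t] also has value [i t']; since both edges start at the same
     vertex, the two values agree. *)
  + have [f ft] := st_surj E (i t); have := ft; rewrite H -EE' ft => /i_inj e; subst t'.
    by apply: scover_eq => //; case: Et => _ _ <-; case: Et' => _ _ <-.
- have HV (E1 E2 E1' E2' : scover 1) d t a : consecutive E1 E2 -> upar E1 E1' -> upar E2 E2' ->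
      st E1' = st E2' -> horizontal E1 d t -> vertical E2 a -> N a (i t) ->
      consecutive E1' E2'.
    move=> /consecutive_st E12 u1 u2 E12' Et Ea Na.
    have [d' [t' [E't Ht]]] := upar_horizontal u1 Et.
    have [a' [E'a _ Ha]] := upar_vertical u2 Ea.
    (* At this base point, the value [i t] is carried along the first hyperplane and the property
       [N a] along the second; they meet again at the new vertex as [N a' (i t')]. *)
    have [f ft] := st_surj E1 (i t).
    apply: (horizontal_consecutive E12' E't E'a).
    by rewrite -(Ht _ ft) E12'; apply: Ha; rewrite -E12 ft.
  move=> E1 E2 E1' E2' E12 u1 u2 /(congr1 (@st _)); rewrite !st_base => E12'.
  case: (consecutive_cases E12).
  + move=> [a1 [a2 [Ea1 Ea2 a12]]].
    have [a1' [Ea1' ua1 _]] := upar_vertical u1 Ea1.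
    have [a2' [Ea2' ua2 _]] := upar_vertical u2 Ea2.
    apply: (vertical_consecutive E12' Ea1' Ea2'); apply: (es_inter Zs) a12 ua1 ua2 _.
    by case: Ea1' => -> _; case: Ea2' => -> _; rewrite E12'.
  + by move=> [d [t [a [Et Ea Na]]]]; apply: HV Et Ea Na.
  + move=> [d [t [a [Ea Et Na]]]]; apply: consecutive_sym.
    by apply: HV Et Ea Na => //; apply: consecutive_sym.
Qed.

Lemma scover_listable : listable K -> listable (Z 0) -> listable F -> listable (scover 0).
Proof.
move=> Kf Zf Ff; apply: (listable_inj (f := @state _ _ _ _ _)).
  by move=> V V' VV'; apply: scover_vert; rewrite /st VV'.
by apply: listable_sig; do !apply: listable_prod => //; apply: listable_fun.
Qed.

Lemma scover_special : special scover.
Proof. exact: edges_special scover_npc scover_edge_special. Qed.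

End SpecialCover.

Lemma charts_virtually_special (X B Z : cube_complex) (C : chart_system X B)
    (pi : cmap Z B) (k0 : chart_index C) (z0 : Z 0) :
  covering pi -> edge_special Z -> connected X ->
  listable (chart_index C) -> listable (Z 0) -> listable (Z 1) -> listable (X 1) ->
  virtually_special X.
Proof.
move=> pi_cov Zs X_conn Kf Z0f Z1f X1f.
have Pf : listable (pullback C pi 0).
  (* A vertex of the pullback is determined by the strip edge over it, the chart where that edge
     starts and the vertex of Z. Injectivity is read off [hor_edge_fun], with [unit] as a
     placeholder for [F], which is not constructed yet. *)
  apply: (listable_inj (f := fun t : pullback C pi 0 =>
    (pullback_map C pi _ t, strip_end (pb_index t) false, strip_edge false (pb_strip t)))).
    move=> t t' [e1 e2 e3].
    by have [] := @hor_edge_fun _ _ _ _ pi unit (strip_edge false (pb_strip t))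
      (strip_end (pb_index t) false, pullback_map C pi _ t, id) false t false t'.
  by do !apply: listable_prod.
have [F [p [N [i [[Ff i_inj] [[p1 p2 p3] [[N1 N2 N3] [H1 H2]]]]]]]] :=
  completion (pullback_isometry (C := C) (pi := pi)) Zs Pf Z1f.
exists (scover pi p k0 z0), (scover_proj pi p k0 z0); split; [|split; [|split]].
- exact: (scover_connected pi_cov p1 p2 p3).
- exact: (scover_covering pi_cov X_conn p1 p2 p3).
- move=> x; have [l lP] := scover_listable pi_cov p k0 z0 Kf Z0f Ff.
  by exists l => y _; apply: lP.
- exact: (scover_special pi_cov Zs X_conn i_inj p1 p2 p3 N1 N2 N3 H1 H2).
Qed.

(** * Locally constant vertex spaces *)

Lemma cmap_eq (A B : cube_complex) (f g : cmap A B) :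
  (forall n x, f n x = g n x) -> f = g.
Proof.
case: f g => [f fP] [g gP] /= fg; have e : f = g.
  by apply: functional_extensionality_dep => n; apply: functional_extensionality.
by subst g; rewrite (proof_irrelevance _ fP gP).
Qed.

Definition cmap_id (A : cube_complex) : cmap A A :=
  @CMap A A (fun n x => x) (fun m n f c => erefl).

Lemma cmap_comp_face (A B D : cube_complex) (g : cmap B D) (f : cmap A B) m n
    (h : face_map m n) (c : A n) :
  g _ (f _ (face h c)) = face h (g _ (f _ c)).
Proof. by rewrite !cmap_face. Qed.

Definition cmap_comp (A B D : cube_complex) (g : cmap B D) (f : cmap A B) : cmap A D :=
  @CMap A D (fun n x => g _ (f _ x)) (@cmap_comp_face A B D g f).

Section Inverse.

Variables (A B : cube_complex) (f : cmap A B) (f_iso : cubical_isometry f).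

Lemma isometry_surj n (y : B n) : exists x, f n x = y.
Proof. by have [g _ gK] := f_iso n; exists (g y). Qed.

Lemma isometry_inj n : injective (f n).
Proof. exact: bij_inj (f_iso n). Qed.

Definition inv_fun n (y : B n) : A n :=
  proj1_sig (constructive_indefinite_description _ (isometry_surj y)).

Lemma inv_funK n (y : B n) : f n (inv_fun y) = y.
Proof. by rewrite /inv_fun; case: constructive_indefinite_description. Qed.

Lemma inv_fun_face m n (h : face_map m n) (y : B n) :
  inv_fun (face h y) = face h (inv_fun y).
Proof. by apply: isometry_inj; rewrite cmap_face !inv_funK. Qed.

Definition cmap_inv : cmap B A := @CMap B A inv_fun inv_fun_face.

Lemma cmap_invK n (y : B n) : f n (cmap_inv n y) = y.
Proof. exact: inv_funK. Qed.

Lemma cmap_inv_isometry : cubical_isometry cmap_inv.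
Proof.
move=> n; exists (f n) => x; last by apply: isometry_inj; rewrite cmap_invK.
exact: cmap_invK.
Qed.

End Inverse.

Lemma isometry_comp (A B D : cube_complex) (g : cmap B D) (f : cmap A B) :
  cubical_isometry g -> cubical_isometry f -> cubical_isometry (cmap_comp g f).
Proof. by move=> gi fi n; apply: bij_comp (gi n) (fi n). Qed.

Lemma local_isometry_comp (A B D : cube_complex) (g : cmap B D) (f : cmap A B) :
  cubical_isometry g -> local_isometry f -> local_isometry (cmap_comp g f).
Proof.
move=> gi fi v; have [f1 f2] := fi v; split=> [e e' ev e'v|n c cv ce].
  by move=> /(isometry_inj gi); apply: f1.
have [c0 c0c] := isometry_surj gi c; subst c.
have [||c' [c'v c'c]] := f2 n c0.
- by apply: (isometry_inj gi); rewrite cmap_base.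
- move=> i; have [e [ev ee]] := ce i; exists e; split=> //.
  by apply: (isometry_inj gi); rewrite cmap_face.
by exists c'; split=> //=; rewrite c'c.
Qed.

(** * The chart system of a graph of spaces *)

Section Split.

Variables (G : graph) (XG : graph_of_spaces G) (X : cube_complex).
Variables (pv : forall v, cmap (vspace XG v) X)
  (pe : forall e, cmap (cylinder (espace XG e)) X).
Hypotheses (Q : quotient_map pv pe) (XG_lc : locally_constant XG).

(* Every class of pieces contains exactly one cube of a vertex space, or one cube
   of some X_e x [0,1] that is at neither level. *)
Definition normal_piece n (z : piece XG n) : piece XG n :=
  match z with
  | vpiece v c => vpiece c
  | epiece e (existT c y) =>
      match c return espace XG e (base_dim c) -> piece XG n with
      | inl false => fun y => vpiece (attach_minus XG e _ y)
      | inl true => fun y => vpiece (attach_plus XG e _ y)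
      | inr ks => fun y =>
          epiece (existT (fun c : coord n => espace XG e (base_dim c)) (inr ks) y)
      end y
  end.

Lemma normal_piece_inj n (z z' : piece XG n) :
  piece_map pv pe z = piece_map pv pe z' -> normal_piece z = normal_piece z'.
Proof.
have [_ H] := Q n; move/H; elim=> // {z z'} [z z' []|? ? ? _ -> _ ->] //.
Qed.

Lemma attach_minus_level e n (y : espace XG e n) :
  pe e _ (level false y) = pv (Defs.iota e) _ (attach_minus XG e _ y).
Proof.
have [_ H] := Q n; apply/(H (epiece (level false y)) (vpiece (attach_minus XG e _ y))).
exact: rst_step (glue_minus _).
Qed.

Lemma attach_plus_level e n (y : espace XG e n) :
  pe e _ (level true y) = pv (tau e) _ (attach_plus XG e _ y).
Proof.
have [_ H] := Q n; apply/(H (epiece (level true y)) (vpiece (attach_plus XG e _ y))).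
exact: rst_step (glue_plus _).
Qed.

Lemma vpiece_inj v v' n (c : vspace XG v n) (c' : vspace XG v' n) :
  pv v _ c = pv v' _ c' ->
  existT (fun v => vspace XG v n) v c = existT _ v' c'.
Proof.
move=> e; have := @normal_piece_inj n (vpiece c) (vpiece c') e.
move=> /(congr1 (fun z => if z is vpiece v c
  then Some (existT (fun v => vspace XG v n) v c) else None)).
by move=> /Some_inj.
Qed.

Lemma pv_inj v n : injective (pv v n).
Proof. by move=> c c' /vpiece_inj E; apply: inj_pair2 E. Qed.

Lemma vpiece_prism v n (c : vspace XG v n.+1) e s i (y : espace XG e n) :
  pv v _ c <> pe e _ (prism s i y).
Proof. by move=> E; have := @normal_piece_inj _ (vpiece c) (epiece (prism s i y)) E. Qed.

Lemma prism_inj n e s i (y : espace XG e n) e' s' i' (y' : espace XG e' n) :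
  pe e _ (prism s i y) = pe e' _ (prism s' i' y') ->
  existT (fun e => (bool * 'I_n.+1 * espace XG e n)%type) e (s, i, y) =
  existT _ e' (s', i', y').
Proof.
move=> /(@normal_piece_inj _ (epiece (prism s i y)) (epiece (prism s' i' y'))).
move=> /(congr1 (fun z => if z is epiece e z
  then Some (existT (fun e => cylinder (espace XG e) n.+1) e z) else None)) /Some_inj E.
have ee' : e = e' := congr1 (@projT1 _ _) E; subst e'.
have {}E := inj_pair2 _ _ _ _ _ E.
have [ii' ss'] : inr (i, s) = inr (i', s') :> coord n.+1 := congr1 (@projT1 _ _) E.
by subst i' s'; rewrite (inj_pair2 _ _ _ _ _ E).
Qed.

Lemma split_cases n (c : X n.+1) :
  (exists v c', pv v _ c' = c) \/ (exists e s i y, pe e _ (@prism _ s n i y) = c).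
Proof.
have [z <-] := (Q n.+1).1 c; case: z => [v c'|e [[[]|[i s]] y]] /=.
- by left; exists v, c'.
- left; exists (tau e), (attach_plus XG e _ y); exact/esym/attach_plus_level.
- left; exists (Defs.iota e), (attach_minus XG e _ y); exact/esym/attach_minus_level.
- by right; exists e, s, i, y.
Qed.

Lemma split_vertex (x : X 0) : exists v z, pv v _ z = x.
Proof.
have [z <-] := (Q 0).1 x; case: z => [v c'|e [[[]|[[] //]] y]] /=.
- by exists v, c'.
- by exists (tau e), (attach_plus XG e _ y); exact/esym/attach_plus_level.
- by exists (Defs.iota e), (attach_minus XG e _ y); exact/esym/attach_minus_level.
Qed.

Lemma base_prism n e s i (y : espace XG e n) :
  base (pe e _ (prism s i y)) = pe e _ (level s (base y)).
Proof.
rewrite /base -cmap_face (@prism_face_level _ _ _ _ _ _ _ (corner n) false) ?addbF //.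
  by rewrite faceE.
by move=> l; rewrite !faceE.
Qed.

Definition theta e : cmap (vspace XG (Defs.iota e)) (vspace XG (tau e)) :=
  proj1_sig (constructive_indefinite_description _ (XG_lc e)).

Lemma theta_isometry e : cubical_isometry (theta e).
Proof. by rewrite /theta; case: constructive_indefinite_description => ? []. Qed.

Lemma theta_attach e n (y : espace XG e n) :
  theta e _ (attach_minus XG e _ y) = attach_plus XG e _ y.
Proof. by rewrite /theta; case: constructive_indefinite_description => ? []. Qed.

Variable v0 : vertex G.
Local Notation B := (vspace XG v0).

Definition marking (v : vertex G) : Type :=
  {a : cmap B (vspace XG v) | cubical_isometry a}.

Lemma marking_eq v (a a' : marking v) :
  (forall n x, sval a n x = sval a' n x) -> a = a'.
Proof.
case: a a' => [a aP] [a' a'P] /= aa'; have e := cmap_eq aa'; subst a'.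
by rewrite (proof_irrelevance _ aP a'P).
Qed.

Definition push e (a : marking (Defs.iota e)) : marking (tau e) :=
  exist _ _ (isometry_comp (@theta_isometry e) (svalP a)).

Lemma push_inj e : injective (@push e).
Proof.
move=> a a' aa'; apply: marking_eq => n x; apply: (isometry_inj (@theta_isometry e)).
exact: (congr1 (fun a : marking (tau e) => sval a n x) aa').
Qed.

(** Every marking at the terminal vertex of an edge comes from the initial one, so that in [mstar]
    strips leave from all marked vertices at that end. *)
Lemma push_surj e (a : marking (tau e)) : exists a', push a' = a.
Proof.
exists (exist _ _ (isometry_comp (cmap_inv_isometry (@theta_isometry e)) (svalP a))).
by apply: marking_eq => n x /=; apply: (cmap_invK (@theta_isometry e)).
Qed.

Definition mchart (k : {v : vertex G & marking v}) : cmap B X :=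
  cmap_comp (pv (projT1 k)) (sval (projT2 k)).

Definition mspace (j : {e : edge G & marking (Defs.iota e)}) : cube_complex :=
  espace XG (projT1 j).

(** Read in the markings [a] and [push a] at the two ends, both attaching maps of the edge become
    this single map, because [theta] carries one to the other. *)
Definition mmap (j : {e : edge G & marking (Defs.iota e)}) : cmap (mspace j) B :=
  cmap_comp (cmap_inv (svalP (projT2 j))) (attach_minus XG (projT1 j)).

Definition mstrip (j : {e : edge G & marking (Defs.iota e)}) : cmap (cylinder (mspace j)) X :=
  pe (projT1 j).

Definition mend (j : {e : edge G & marking (Defs.iota e)}) (s : bool) :
    {v : vertex G & marking v} :=
  if s then existT _ (tau (projT1 j)) (push (projT2 j))
  else existT _ (Defs.iota (projT1 j)) (projT2 j).

Lemma mlevel j s n (y : mspace j n) :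
  mstrip j _ (level s y) = mchart (mend j s) _ (mmap j _ y).
Proof.
have H := cmap_invK (svalP (projT2 j)) (attach_minus XG (projT1 j) _ y).
case: s => /=; first by rewrite H theta_attach; apply: attach_plus_level.
by rewrite H; apply: attach_minus_level.
Qed.

Lemma mchart_inj k n : injective (mchart k n).
Proof. by move=> x x' /pv_inj/(isometry_inj (svalP (projT2 k))). Qed.

Lemma mstar k b n (c : X n.+1) : base c = mchart k _ b ->
  (exists c', mchart k _ c' = c) \/
  (exists j s i (y : mspace j n), mend j s = k /\ mstrip j _ (prism s i y) = c).
Proof.
case: k => v a cb; have [[v' [c' c'c]]|[e [s [i [y yc]]]]] := split_cases c; [left|right].
  move: cb; rewrite -c'c -cmap_base => /vpiece_inj E.
  have vv' : v' = v := congr1 (@projT1 _ _) E; subst v'.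
  have [x xc'] := isometry_surj (svalP a) c'.
  by exists x; rewrite -xc'.
move: cb; rewrite -yc base_prism; case: s yc => yc.
  rewrite attach_plus_level => /vpiece_inj E.
  have ve : tau e = v := congr1 (@projT1 _ _) E; subst v.
  have [a' a'a] := push_surj a.
  by exists (existT _ e a'), true, i, y; rewrite /mend /= a'a.
rewrite attach_minus_level => /vpiece_inj E.
have ve : Defs.iota e = v := congr1 (@projT1 _ _) E; subst v.
by exists (existT _ e a), false, i, y.
Qed.

Lemma mstrip_inj n j s i (y : mspace j n) j' s' i' (y' : mspace j' n) :
  mstrip j _ (prism s i y) = mstrip j' _ (prism s' i' y') ->
  mend j s = mend j' s' ->
  existT (fun j => (bool * 'I_n.+1 * mspace j n)%type) j (s, i, y) =
  existT _ j' (s', i', y').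
Proof.
case: j y => [e a] y; case: j' y' => [e' a'] y' /prism_inj E.
have ee' : e = e' := congr1 (@projT1 _ _) E; subst e'.
have [<- <- <-] := inj_pair2 _ _ _ _ _ E; rewrite /mend /= => E'.
suff -> : a = a' by [].
case: s {E} E' => E'; last exact: inj_pair2 E'.
by apply: push_inj; apply: inj_pair2 E'.
Qed.

Definition split_charts : chart_system X B :=
  @ChartSystem X B _ mchart _ mspace mmap mstrip mend mlevel mchart_inj
    (fun k n c j s i y => @vpiece_prism _ _ _ _ s i y)
    mstar mstrip_inj (@vspace_npc G XG v0) (fun j => @espace_npc G XG (projT1 j))
    (fun j => local_isometry_comp (cmap_inv_isometry (svalP (projT2 j)))
                (@attach_minus_isometry G XG (projT1 j))).

Lemma listable_cubes (Y : cube_complex) n : listable {n & Y n} -> listable (Y n).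
Proof. apply: (listable_inj (f := existT _ n)) => c c' E; apply: inj_pair2 E. Qed.

Lemma listable_cmap (Y Y' : cube_complex) :
  listable {n & Y n} -> listable {n & Y' n} -> listable (cmap Y Y').
Proof.
move=> Yf Y'f; apply: (listable_inj (f := fun (f : cmap Y Y') (t : {n & Y n}) =>
  existT _ (projT1 t) (f _ (projT2 t)) : {n & Y' n})); last exact: listable_fun.
move=> f g fg; apply: cmap_eq => n x.
exact: inj_pair2 (congr1 (fun h => h (existT _ n x)) fg).
Qed.

Lemma listable_base : compact X -> listable {n & B n}.
Proof.
apply: (listable_inj (f := fun t : {n & B n} =>
  existT _ (projT1 t) (pv v0 _ (projT2 t)) : {n & X n})) => -[n c] [n' c'] E.
have nn' : n = n' := congr1 (@projT1 _ _) E; subst n'.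
by congr existT; apply: pv_inj; apply: inj_pair2 E.
Qed.

(** A marked vertex is determined by its chart: the images of distinct vertex spaces are disjoint
    and each embeds in X. Charts are cubical maps between finite complexes. *)
Lemma listable_charts : compact X -> listable {v : vertex G & marking v}.
Proof.
move=> X_comp; apply: (listable_inj (f := mchart)); last first.
  exact: listable_cmap (listable_base X_comp) X_comp.
have [[b] _] := vspace_connected XG v0.
move=> [v a] [v' a'] E.
have /vpiece_inj/(congr1 (@projT1 _ _))/= vv' := congr1 (fun f : cmap B X => f _ b) E.
subst v'; congr existT; apply: marking_eq => n x.
exact: pv_inj (congr1 (fun f : cmap B X => f _ x) E).
Qed.

End Split.

Theorem theorem1p4 (X : cube_complex) (X_compact : compact X)
    (X_connected : connected X)
    (G : graph) (G_connected : connected_graph G) (XG : graph_of_spaces G)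
    (X_splits : splits_as X XG)
    (XG_virtually_special : graph_of_virtually_special XG)
    (XG_locally_constant : locally_constant XG) :
  virtually_special X.
Proof.
have [pv [pe Q]] := X_splits.
have [[x0] _] := X_connected; have [v0 [_ _]] := split_vertex Q x0.
have [Z [pi [[[z0] _] [pi_cov [pi_fin Zs]]]]] := XG_virtually_special.1 v0.
have Bf := listable_base Q v0 X_compact.
have Z0f : listable (Z 0) := listable_fibers (listable_cubes 0 Bf) pi_fin.
(* The identity marking of B supplies the base chart. *)
have idP : cubical_isometry (cmap_id (vspace XG v0)) by move=> n; exists id.
apply: (@charts_virtually_special _ _ _ (split_charts Q XG_locally_constant v0) pi
  (existT _ v0 (exist _ _ idP)) z0 pi_cov (special_edges Zs) X_connected) => //.
- exact: listable_charts.
- apply: (listable_inj (f := fun a : Z 1 => (init a, pi _ a))).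
    by move=> a a' []; apply: covering_inj.
  by apply: listable_prod => //; apply: listable_cubes.
- exact: listable_cubes.
Qed.
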